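(* There exists a class $\mathbf{L}$ of pairwise non-embeddable linearly ordered continua such that, for every cardinal $\kappa>\aleph_0$, the class $\mathbf{L}$ contains $2^\kappa$ spaces of weight $\kappa$ and size $\max\{\kappa,2^{\aleph_0}\}$.
   Context: A continuum is a compact and connected Hausdorff space with more than one point. A topological space is linearly ordered if its topology is the order topology of some linear ordering of its underlying set. The size of a space $X$ is its cardinality $|X|$; the weight $w(X)$ is the least infinite cardinality of a basis of the topology. A space $X$ is embeddable in $Y$ if $X$ is homeomorphic to a subspace of $Y$. Spaces in a class are pairwise non-embeddable if for any two distinct members $X,Y$ of the class, $X$ is not embeddable in $Y$ (and $Y$ is not embeddable in $X$). The class may be a proper class. *)

(* Defs.v *)
From HB Require Import structures.
From mathcomp Require Import all_boot all_order all_algebra.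
From mathcomp Require Import all_classical.
From mathcomp Require Import all_reals topology.

Set Implicit Arguments.
Unset Strict Implicit.
Unset Printing Implicit Defensive.

Local Open Scope classical_set_scope.
Local Open Scope card_scope.

(* Cardinals are represented by arbitrary types: the type [K] stands for the
   cardinal of [set: K], and [set K] for 2 to that power. *)

Definition gt_aleph0 (K : Type) : Prop :=
  [set: nat] #<= [set: K] /\ [set: nat] #!= [set: K].

(* The cardinal of A is the maximum of those of B and C. *)
Definition card_eq_max (T U V : Type) (A : set T) (B : set U) (C : set V) :
    Prop :=
  (B #<= C /\ A #= C) \/ (C #<= B /\ A #= B).

Definition continuum (X : topologicalType) : Prop :=
  [/\ compact [set: X], connected [set: X], hausdorff_space X
    & exists x y : X, x <> y].

(* An [orderTopologicalType] is a topological space with a total order whose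
   order topology is the given topology; the equality says that X underlies
   such a structure. *)
Definition linearly_ordered_space (X : topologicalType) : Prop :=
  exists (d : Order.disp_t) (Y : orderTopologicalType d),
    X = (Y : topologicalType).

Definition homeomorphic (X Y : topologicalType) : Prop :=
  exists (f : X -> Y) (g : Y -> X),
    [/\ cancel f g, cancel g f, continuous f & continuous g].

(* [set_type A] carries the topology induced by its inclusion in Y. *)
Definition embeddable (X Y : topologicalType) : Prop :=
  exists A : set Y, homeomorphic X (set_type A).

Definition has_weight (X : topologicalType) (K : Type) : Prop :=
  [/\ infinite_set [set: K],
      exists2 B : set (set X), basis B & B #= [set: K]
    & forall B : set (set X), basis B -> infinite_set B -> [set: K] #<= B].

(* Classes of spaces are predicates on [topologicalType] rather than terms of
   type [set topologicalType]: the library's universe constraints force [set]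
   and [topologicalType] to live at the same level. *)
Definition pairwise_non_embeddable (L : topologicalType -> Prop) : Prop :=
  forall X Y : topologicalType, L X -> L Y -> X <> Y -> ~ embeddable X Y.

(* The class C has exactly as many members as T has elements. *)
Definition class_card_eq (C : topologicalType -> Prop) (T : Type) : Prop :=
  exists f : T -> topologicalType,
    injective f /\ forall X : topologicalType, C X <-> exists t : T, X = f t.

(* Main.v *)
Require Import Defs.
From HB Require Import structures.
From mathcomp Require Import all_boot all_order all_algebra.
From mathcomp Require Import all_classical.
From mathcomp Require Import all_reals topology.
From mathcomp Require Import Rstruct lra.

Set Implicit Arguments.
Unset Strict Implicit.
Unset Printing Implicit Defensive.
Import Order.TTheory GRing.Theory Num.Theory.
Local Open Scope classical_set_scope.
Local Open Scope card_scope.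
Local Open Scope order_scope.

(** Why it is true.  A continuous injection on a connected linear order
    preserves betweenness, and connected sets are convex, so an embedding of
    one linearly ordered continuum into another is a strictly monotone map
    with convex image ([embeddable_monotone]).  It is thus enough to find, for
    every uncountable cardinal kappa, 2^kappa dense complete orders of the
    right weight and size, such that none of them, over all kappa, is
    isomorphic or anti-isomorphic to an interval of another.

    Each of these orders spells a word, that is, a function from a well-order J
    with a last element to the two letters true and false.  Every letter is
    replaced by a copy of omega_1 + 1, in its natural order for the letter true
    and reversed for the letter false, and the jumps of the resulting order are
    then filled with open unit intervals.  The point at infinity of the copy at
    j, the mark of j, cannot be approached by a countable set from the left if
    the letter is true, nor from the right if the letter is false.  If true
    occurs only at positions that have an immediate predecessor, then no other
    point has such a side ([left_mark], [right_mark]).  Inapproachability by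
    countable sets is inherited along monotone maps with convex image
    ([unreachable_image], [unreachable_preimage]), so an embedding maps marks
    to marks.  A decreasing one would reverse an infinite part of a well-order
    ([not_decreasing]); an increasing one induces an order embedding of the
    positions with convex image that respects the letters
    ([word_embedding]).

    The word of a subset A of kappa has the positions (kappa + 1) x omega,
    ordered lexicographically, and one last position.  Letter 4 of block k
    tells whether k is in A, the letters 1 and 2 of the first and of the last
    block are true, and all the others are false.  Two consecutive letters true
    occur only in the first and in the last block, hence any convex embedding
    of one such word into another matches both ends ([ends_image]).  It is then
    a bijection of the positions in between, so that the cardinals agree
    ([embeddable_same_card]); if moreover the two well-orders are the same, it
    is the identity there, and the two subsets are equal ([word_rigid]).

    A class whose distinct members never embed in each other contains one space
    only from each homeomorphism class; therefore one type of each cardinality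
    is chosen once and for all ([representative]).

    For the weight, kappa * kappa = kappa ([infinite_card_square]) bounds the
    number of intervals with rational end points, while kappa disjoint open
    intervals bound every basis from below ([card_le_basis]).  For the size,
    a point is a position in the unfilled order, of cardinality kappa, together
    with a real number ([word_continuum_card_le]), and one filled jump contains
    a copy of the power set of the natural numbers
    ([continuum_le_word_continuum]). *)

(** * Well-orders and twisted lexicographic products *)

Definition well_ordered d (T : porderType d) :=
  forall P : set T, P !=set0 -> exists2 x, P x & forall y, P y -> x <= y.

(** As [P] can be empty or full, a complete order has both end points. *)
Definition complete d (T : porderType d) :=
  forall P : set T, exists s, forall y, (forall x, P x -> x <= y) <-> s <= y.

Definition jump d (S : porderType d) (s : S) :=
  exists2 s', s < s' & forall x, ~ (s < x < s').

(** An alias of a type that carries an arbitrary well-order of it. *)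
Definition WO (T : Type) : Type := T.
HB.instance Definition _ T := Choice.copy (WO T) {classic T}.

Lemma exists_well_order (T : Type) : exists R : rel (WO T),
  [/\ reflexive R, antisymmetric R, transitive R, total R &
    forall P : set (WO T), P !=set0 -> exists2 x, P x & forall y, P y -> R x y].
Proof.
have [R wR] := wochoice.well_ordering_principle (WO T).
have minR (P : set (WO T)) : P !=set0 -> exists2 x, P x & forall y, P y -> R x y.
  move=> [x Px]; have [|z [[zP lz] _]] := wR (mem P).
    by exists x; exact: mem_set.
  by exists z => [|y Py]; [exact: set_mem | apply: lz; exact: mem_set].
have tR : total R.
  move=> x y; have [|z [->|->] zR] := minR [set x; y]; first by exists x; left.
  - by rewrite zR //; right.
  - by rewrite orbC zR //; left.
have rR : reflexive R by move=> x; have := tR x x; rewrite orbb.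
have aR : antisymmetric R.
  move=> x y /andP[xy yx].
  have [|z [_ zu]] := wR (mem [set x; y]); first by exists x; apply/mem_set; left.
  by rewrite -(zu x) ?(zu y) //; split; try (by apply/mem_set; constructor);
    move=> w /set_mem[] ->.
exists R; split => //.
- move=> y x z xy yz.
  have [|w wP wm] := minR [set x; y; z]; first by exists x; left; left.
  have wx : R w x by apply: wm; left; left.
  have wy : R w y by apply: wm; left; right.
  have wz : R w z by apply: wm; right.
  case: wP => [[wEx|wEy]|wEz].
  - by rewrite -wEx.
  - by have -> : x = y by apply: aR; rewrite xy -wEy wx.
  - have zy : z = y by apply: aR; rewrite yz -wEz wy.
    by have -> : x = z by apply: aR; rewrite -{2}wEz wx zy xy.
Qed.

Section WO.
Variable T : Type.
Definition wo_le : rel (WO T) := sval (cid (exists_well_order T)).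
Let wo_leP : [/\ reflexive wo_le, antisymmetric wo_le, transitive wo_le,
    total wo_le & forall P : set (WO T), P !=set0 ->
      exists2 x, P x & forall y, P y -> wo_le x y].
Proof. exact: svalP (cid (exists_well_order T)). Qed.
Lemma wo_le_refl : reflexive wo_le. Proof. by case: wo_leP. Qed.
Lemma wo_le_anti : antisymmetric wo_le. Proof. by case: wo_leP. Qed.
Lemma wo_le_trans : transitive wo_le. Proof. by case: wo_leP. Qed.
Lemma wo_le_total : total wo_le. Proof. by case: wo_leP. Qed.
HB.instance Definition _ := @Order.Le_isPOrder.Build (Order.Disp tt tt) (WO T)
  wo_le wo_le_refl wo_le_anti wo_le_trans.
HB.instance Definition _ := @Order.POrder_isTotal.Build (Order.Disp tt tt)
  (WO T) wo_le_total.
Lemma WO_well_ordered : well_ordered (WO T).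
Proof. by case: wo_leP. Qed.
End WO.

Definition with_last (T : Type) : Type := option T.
HB.instance Definition _ (T : choiceType) := Choice.copy (with_last T) (option T).
Section with_last.
Context {d} {T : orderType d}.
Definition with_last_le (x y : with_last T) : bool :=
  match y, x with
  | None, _ => true
  | Some _, None => false
  | Some b, Some a => a <= b
  end.
Lemma with_last_le_refl : reflexive with_last_le.
Proof. by case=> //= a. Qed.
Lemma with_last_le_anti : antisymmetric with_last_le.
Proof. by move=> [a|] [b|] //= /le_anti ->. Qed.
Lemma with_last_le_trans : transitive with_last_le.
Proof. by move=> [b|] [a|] [c|] //=; exact: le_trans. Qed.
Lemma with_last_le_total : total with_last_le.
Proof. by move=> [a|] [b|] //=; exact: le_total. Qed.
HB.instance Definition _ := @Order.Le_isPOrder.Build d (with_last T)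
  with_last_le with_last_le_refl with_last_le_anti with_last_le_trans.
HB.instance Definition _ := @Order.POrder_isTotal.Build d (with_last T) with_last_le_total.
Lemma with_last_leS (a b : T) : ((Some a : with_last T) <= Some b) = (a <= b).
Proof. by []. Qed.
Lemma with_last_ltS (a b : T) : ((Some a : with_last T) < Some b) = (a < b).
Proof. by rewrite !lt_neqAle. Qed.
Lemma with_last_leN (x : with_last T) : x <= None.
Proof. by []. Qed.
Lemma with_last_ltSN (a : T) : (Some a : with_last T) < None.
Proof. by rewrite lt_neqAle. Qed.
End with_last.

Definition suborder d (T : orderType d) (P : pred T) : Type := {x : T | P x}.
HB.instance Definition _ d (T : orderType d) (P : pred T) :=
  SubChoice.copy (suborder P) {x : T | P x}.
HB.instance Definition _ d (T : orderType d) (P : pred T) :=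
  [SubChoice_isSubOrder of suborder P by <: with Order.Disp tt tt].

(** The sum over [I] of copies of [F], where the copy at [i] is reversed when
    [e i] is false.  With [e] constantly true this is the usual lexicographic
    product. *)
Definition tlex (I F : Type) (e : I -> bool) : Type := (I * F)%type.
HB.instance Definition _ (I F : choiceType) e := Choice.copy (@tlex I F e) (I * F)%type.
Section tlex.
Context {d d'} {I : orderType d} {F : orderType d'} {e : I -> bool}.
Local Notation T := (@tlex I F e).
Definition tlex_lt (x y : T) : bool :=
  (x.1 < y.1) || (x.1 == y.1) && (if e x.1 then x.2 < y.2 else y.2 < x.2).
Lemma tlex_lt_irr : irreflexive tlex_lt.
Proof. by move=> x; rewrite /tlex_lt ltxx eqxx /= !ltxx if_same. Qed.
Lemma tlex_lt_trans : transitive tlex_lt.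
Proof.
move=> [b v] [a u] [c w]; rewrite /tlex_lt /=.
move=> /orP[ab|/andP[/eqP-> uv]] /orP[bc|/andP[/eqP<- vw]].
- by rewrite (lt_trans ab).
- by rewrite ab.
- by rewrite bc.
- rewrite eqxx ltxx /=; move: uv vw; case: ifP => _; first exact: lt_trans.
  by move=> vu wv; apply: lt_trans vu.
Qed.
HB.instance Definition _ := @Order.Lt_isPOrder.Build (Order.Disp tt tt) T
  tlex_lt tlex_lt_irr tlex_lt_trans.
Lemma tlex_ltE (x y : T) : (x < y) = 
  (x.1 < y.1) || (x.1 == y.1) && (if e x.1 then x.2 < y.2 else y.2 < x.2).
Proof. by []. Qed.
Lemma tlex_total : total (<=%O : rel T).
Proof.
move=> [a u] [b v]; rewrite !le_eqVlt !tlex_ltE /=.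
have [ab|ba|->] := ltgtP a b; rewrite ?orbT //=.
have [uv|vu|->] := ltgtP u v; rewrite ?eqxx //=; case: ifP => //; rewrite ?orbT //.
Qed.
HB.instance Definition _ := @Order.POrder_isTotal.Build (Order.Disp tt tt) T
  tlex_total.
End tlex.

(** * Cardinal arithmetic *)

Lemma fun_card_le T U (A : set T) (B : set U) (f : T -> U) :
  (forall x, A x -> B (f x)) ->
  (forall x y, A x -> A y -> f x = f y -> x = y) -> A #<= B.
Proof.
move=> fAB finj; apply: card_le_trans (subset_card_le (A := f @` A) _).
- have : f @` A #= A by apply: inj_card_eq => x y /set_mem ? /set_mem ?; exact: finj.
  by rewrite card_eqPle => -[].
- by move=> _ [x /fAB ? <-].
Qed.

Lemma card_le_fun T U (A : set T) (B : set U) : A !=set0 -> A #<= B ->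
  exists2 f : T -> U, (forall x, A x -> B (f x)) &
    (forall x y, A x -> A y -> f x = f y -> x = y).
Proof.
move=> [a Aa] /card_leP[f].
pose u0 := val (f (SigSub (mem_set Aa))).
pose g x := if pselect (A x) is left Ax then val (f (SigSub (mem_set Ax))) else u0.
exists g => [x|x y] Ax; rewrite /g; case: pselect => // Ax'.
  exact: set_valP.
move=> Ay; case: pselect => // Ay' /val_inj fxy.
have /(congr1 val) // : SigSub (mem_set Ax') = SigSub (mem_set Ay').
by apply: inj fxy; rewrite inE.
Qed.

Lemma inj_card_leT T U (f : T -> U) : injective f -> [set: T] #<= [set: U].
Proof. by move=> fI; apply: (fun_card_le (f := f)) => // x y _ _ /fI. Qed.

Lemma card_leT_inj T U : T -> [set: T] #<= [set: U] -> exists f : T -> U, injective f.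
Proof.
move=> t /card_le_fun[|f _ fI]; first by exists t.
by exists f => x y; exact: fI.
Qed.

Lemma card_le_setX T U T' U' (A : set T) (B : set U) (A' : set T') (B' : set U') :
  A #<= A' -> B #<= B' -> A `*` B #<= A' `*` B'.
Proof.
move=> AA BB; have [->|/set0P[[a b] [/= Aa Bb]]] := eqVneq (A `*` B) set0.
  exact: card_ge0.
have [|f fA fI] := card_le_fun _ AA; first by exists a.
have [|g gB gI] := card_le_fun _ BB; first by exists b.
apply: (fun_card_le (f := fun x => (f x.1, g x.2))).
  by move=> [x y] [/= /fA ? /gB].
move=> [x y] [z t] [/= Ax By] [/= Az Bt] [/fI fxz /gI gyt].
by rewrite fxz // gyt.
Qed.

Lemma well_ordered_ind d (T : orderType d) : well_ordered T ->
  forall P : T -> Prop, (forall x, (forall y, y < x -> P y) -> P x) ->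
  forall x, P x.
Proof.
move=> wT P IH x; apply: contrapT => nPx.
have [|y nPy ymin] := wT [set y | ~ P y]; first by exists x.
apply: nPy; apply: IH => z zy; apply: contrapT => /ymin.
by rewrite leNgt zy.
Qed.

Lemma well_ordered_wf d (T : orderType d) : well_ordered T ->
  well_founded (fun x y : T => x < y).
Proof. by move=> /well_ordered_ind; apply => x IH; constructor. Qed.

(** By recursion on [x], send [x] in [D] to a point of [A] that is not yet a
    value: there is one, as the earlier values are too few to exhaust [A].
    Both the comparability of cardinals and the square of an infinite cardinal
    are obtained from this one recursion. *)
Lemma well_ordered_card_le d (T : orderType d) U (D : set T) (A : set U) :
  well_ordered T -> (forall x, D x -> ~ (A #<= [set y | D y /\ y < x])) ->
  D #<= A.
Proof.
move=> wT small; have [->|/set0P[x0 Dx0]] := eqVneq D set0; first exact: card_ge0.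
have [A0|/set0P[u0 _]] := eqVneq A set0.
  by case: (small x0 Dx0); rewrite A0 card_ge0.
pose free x (f : forall y, y < x -> U) : set {classic U} :=
  [set u | A u /\ forall y (yx : y < x), D y -> f y yx <> u].
pose F x f := @xget {classic U} u0 (@free x f).
pose h : T -> U := Fix (well_ordered_wf wT) (fun=> U) F.
have hE x : h x = F x (fun y _ => h y).
  rewrite {1}/h Fix_eq //; move=> y f g fg; congr F.
  by apply: functional_extensionality_dep => z; apply: functional_extensionality_dep.
have hP x : D x -> A (h x) /\ forall y, y < x -> D y -> h y <> h x.
  move=> Dx; rewrite [h x]hE /F.
  suff [u uP] : exists u, free x (fun y _ => h y) u.
    by have := @xgetPex {classic U} u0 _ (ex_intro _ u uP).
  apply: contrapT => nfree; apply: (small x Dx).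
  apply: card_le_trans (card_image_le h _); apply: subset_card_le => u Au.
  apply: contrapT => nu; apply: nfree; exists u; split=> // y yx Dy hy.
  by apply: nu; exists y.
apply: (fun_card_le (f := h)) => [x /hP[]//|x y Dx Dy hxy].
have [xy|yx|//] := ltgtP x y.
- by case: (hP y Dy) => _ /(_ x xy Dx).
- by case: (hP x Dx) => _ /(_ y yx Dy); rewrite hxy.
Qed.

Lemma card_le_total T U (A : set T) (B : set U) : A #<= B \/ B #<= A.
Proof.
have [|noinit] := pselect (exists2 x : WO T, A x & B #<= [set y : WO T | A y /\ y < x]).
  move=> [x _ Bx]; right; apply: (card_le_trans Bx).
  by apply: subset_card_le => y [].
left; apply: (@well_ordered_card_le _ (WO T) U A B (@WO_well_ordered T)).
by move=> x Ax Bx; apply: noinit; exists x.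
Qed.

(** Shift a sequence of distinct points of [A] by one, to make room for [x]. *)
Lemma infinite_card_setU1 T (A : set T) (x : T) : infinite_set A ->
  x |` A #<= A.
Proof.
move=> /infiniteP /card_le_fun[|g gA gI]; first by exists 0%N.
pose f y := if pselect (A y) is left _ then
    (if pselect (exists n, g n = y) is left e then g (sval (cid e)).+1 else y)
  else g 0%N.
have fg n : f (g n) = g n.+1.
  rewrite /f; case: pselect => [_|]; last by move: (gA n I).
  case: pselect => [e|]; last by case; exists n.
  by case: cid => m /= /gI ->.
have fA y : (exists n, y = g n) \/
    (f y = y /\ A y /\ forall n, g n <> y) \/ (~ A y /\ f y = g 0%N).
  rewrite /f; case: pselect => [Ay|nAy]; last by right; right.
  case: pselect => [[n gn]|ne]; first by left; exists n.
  by right; left; split=> //; split=> // n gn; apply: ne; exists n.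
apply: (fun_card_le (f := f)) => [y _|y z].
  case: (fA y) => [[n ->]|[[-> []]|[_ ->]]] //; last exact: gA.
  by rewrite fg; exact: gA.
case: (fA y) => [[n ->]|[[-> [Ay gy]]|[nAy ->]]];
case: (fA z) => [[m ->]|[[-> [Az gz]]|[nAz ->]]]; rewrite ?fg //.
- by move=> _ _ /(gI _ _ I I)[->].
- by move=> _ _ /gz.
- by move=> _ _ /(gI _ _ I I).
- by move=> _ _ /esym /gy.
- by move=> _ _ /esym /gy.
- by move=> _ _ /(gI _ _ I I).
- by move=> _ _ /gz.
- by move=> [->|//] [->|//].
Qed.

Lemma tlex_well_ordered d d' (I : orderType d) (F : orderType d') :
  well_ordered I -> well_ordered F -> well_ordered (@tlex I F (fun=> true)).
Proof.
move=> wI wF P [[i0 u0] Pi0].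
have [|i [v Piv] imin] := wI [set i | exists u, P (i, u)]; first by exists i0, u0.
have [|u Piu umin] := wF [set u | P (i, u)]; first by exists v.
exists (i, u) => // -[j w] Pjw; rewrite le_eqVlt tlex_ltE /=.
have := imin j (ex_intro _ _ Pjw); rewrite le_eqVlt => /orP[/eqP ij|->];
  last by rewrite orbT.
subst j; rewrite ltxx eqxx /=; have := umin w Pjw; rewrite le_eqVlt => /orP[/eqP->|->].
  by rewrite eqxx.
by rewrite orbT.
Qed.

Lemma with_last_well_ordered d (T : orderType d) :
  well_ordered T -> well_ordered (with_last T).
Proof.
move=> wT P [x Px]; have [[y Py]|nS] := pselect (exists y, P (Some y)).
  have [|z Pz zmin] := wT [set y | P (Some y)]; first by exists y.
  by exists (Some z) => // -[w|//] Pw; rewrite with_last_leS; exact: zmin.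
case: x Px => [x|] Px; first by case: nS; exists x.
by exists None => // -[y|//] Py; case: nS; exists y.
Qed.

Lemma nat_well_ordered : well_ordered nat.
Proof.
move=> P [n Pn].
have ex : exists n, `[< P n >] by exists n; exact/asboolP.
exists (ex_minn ex); case: ex_minnP => m /asboolP Pm mmin //.
by move=> y Py; rewrite leEnat; apply: mmin; exact/asboolP.
Qed.

Section square.
Context d (T : orderType d).
Hypothesis wT : well_ordered T.

(** If no proper initial segment of [A] is as large as [A], order the pairs by
    their maximum first: the pairs before a given one lie in the square of a
    proper initial segment, and this square is smaller than [A]. *)
Let square_step (A : set T) : (forall x y, A x -> y <= x -> A y) ->
  infinite_set A ->
  (forall a, A a -> infinite_set [set y | y < a] ->
    [set y | y < a] `*` [set y | y < a] #<= [set y | y < a]) ->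
  A `*` A #<= A.
Proof.
move=> Adown Ainf IH.
have [[a Aa Aseg]|nseg] := pselect (exists2 a, A a & A #<= [set y | y < a]).
  apply: (card_le_trans (card_le_setX Aseg Aseg)).
  apply: (card_le_trans (IH a Aa _)).
    by move=> /(card_le_finite Aseg).
  by apply: subset_card_le => y /= ya; apply: Adown (ltW ya).
(* A bijective copy of the pairs, sorted by maximum; the two components serve
   to break ties. *)
pose Q := @tlex T (@tlex T T (fun=> true)) (fun=> true).
pose q (x : T * T) : Q := (Order.max x.1 x.2, x).
apply: (@card_le_trans _ _ _ (q @` (A `*` A))).
  by apply: (fun_card_le (f := q)) => [x Ax|x y _ _ [_ ->]] //; exists x.
apply: well_ordered_card_le.
  by do 2?apply: tlex_well_ordered.
move=> _ [[x y] [/= Ax Ay] <-]; set m := Order.max x y => Aq.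
have Am : A m by rewrite /m; case: leP.
have {}Aq : A #<= [set z | z <= m] `*` [set z | z <= m].
  apply: (card_le_trans Aq); apply: (fun_card_le (f := snd)).
    move=> _ [[[z t] _ <-] /=]; rewrite tlex_ltE /= => /orP[/ltW|/andP[/eqP zt _]].
      by rewrite ge_max => /andP.
    by rewrite -[m]zt !le_max !lexx orbT.
  by move=> _ _ [[z _ <-] _] [[t _ <-] _] /= ->.
have leE : [set z | z <= m] = m |` [set z | z < m].
  by apply/seteqP; split=> z /=; rewrite le_eqVlt => /predU1P.
have [fin|inf] := pselect (finite_set [set z | z < m]).
  apply: Ainf; apply: (card_le_finite Aq).
  by apply: finite_setX; rewrite leE finite_setU; split.
apply: nseg; exists m => //; apply: (card_le_trans Aq).
have le1 : [set z | z <= m] #<= [set z | z < m] by rewrite leE; exact: infinite_card_setU1.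
by apply: (card_le_trans (card_le_setX le1 le1)); exact: IH.
Qed.

Lemma well_ordered_card_square : infinite_set [set: T] -> [set: T * T] #<= [set: T].
Proof.
move=> Tinf.
rewrite -setXTT; apply: square_step => //; move=> a _.
elim/(well_ordered_ind wT): a => a IHa ainf.
by apply: square_step => // x y /= xa yx; exact: le_lt_trans xa.
Qed.
End square.

Lemma infinite_card_square T : infinite_set [set: T] -> [set: T * T] #<= [set: T].
Proof. exact: (well_ordered_card_square (@WO_well_ordered T)). Qed.

(** * Order topologies of dense complete orders *)

Definition densely_ordered d (T : porderType d) :=
  forall x y : T, x < y -> exists z, x < z < y.

Lemma complete_inf d (T : porderType d) : complete T ->
  forall P : set T, exists s, forall y, (forall x, P x -> y <= x) <-> y <= s.
Proof.
move=> cT P; have [s sP] := cT [set y | forall x, P x -> y <= x].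
exists s => y; split=> [yP|ys x Px]; first exact: (proj2 (sP s)).
by apply: (le_trans ys); apply/(sP x) => z; apply.
Qed.

Section order_topology_facts.
Context {d} {T : orderTopologicalType d}.
Implicit Types (x y z : T) (U : set T).

(** [None] stands for a missing end: unbounded intervals are needed as
    neighbourhoods of the two end points of the order. *)
Definition between (l r : option T) (z : T) : Prop :=
  oapp (fun a => a < z) true l /\ oapp (fun b => z < b) true r.

Lemma between_open l r : open (between l r).
Proof.
have openTrue : open (fun z : T => is_true true).
  by rewrite (_ : (fun=> _) = [set: T]); [exact: openT | apply/seteqP; split].
apply: openI.
  by case: l => [a|] /=; [have := rray_open a; rewrite set_itvE | exact: openTrue].
by case: r => [a|] /=; [have := lray_open a; rewrite set_itvE | exact: openTrue].
Qed.

Lemma nbhs_between x U : nbhs x U ->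
  exists l r, between l r x /\ between l r `<=` U.
Proof.
rewrite itv_nbhsE => -[[l r] [/= io xi] iU].
have lE : l = -oo%O \/ exists a, l = BRight a.
  case: l io {xi iU} => [b a|b] io; last by left; rewrite (itv_open_ends_linfty io).
  by right; exists a; rewrite (itv_open_ends_lside io).
have rE : r = +oo%O \/ exists b, r = BLeft b.
  case: r io {xi iU lE} => [b a|b] io; last by left; rewrite (itv_open_ends_rinfty io).
  by right; exists a; rewrite (itv_open_ends_rside io).
case: lE xi iU => [->|[a ->]]; case: rE => [->|[b ->]]; rewrite in_itv /= => xi iU.
- by exists None, None; split => // z _; apply: iU; rewrite /= in_itv.
- exists None, (Some b); split => // z [_ /= zb]; apply: iU; by rewrite /= in_itv.
- exists (Some a), None; split; first by rewrite andbT in xi.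
  by move=> z [/= az _]; apply: iU; rewrite /= in_itv /= andbT.
- exists (Some a), (Some b); split; first exact/andP.
  by move=> z [/= az zb]; apply: iU; rewrite /= in_itv /= az.
Qed.

(** An ultrafilter converges to the infimum of the [x] such that the ray of the
    points up to [x] belongs to it. *)
Lemma complete_compact : complete T -> compact [set: T].
Proof.
move=> cT; rewrite compact_ultra => F FU _.
have [c cP] := complete_inf cT [set x | F [set z | z <= x]].
exists c; split=> // U /nbhs_between[l [r [[lc cr] lrU]]].
apply: (filterS lrU); apply: filterI.
  case: l lc {lrU} => [a|] /= ac; last exact: filterE.
  have [Fa|] := in_ultra_setVsetC [set z | z <= a] FU.
    by move/(cP c): (lexx c) => /(_ a Fa); rewrite leNgt ac.
  by apply: filterS => z /=; rewrite ltNge => /negP.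
case: r cr {lrU} => [b|] /= cb; last exact: filterE.
have [[x Fx xb]|nx] := pselect (exists2 x, F [set z | z <= x] & x < b).
  by apply: filterS Fx => z /= zx; exact: le_lt_trans xb.
have : b <= c by apply/(cP b) => x Fx; rewrite leNgt; apply/negP => xb; apply: nx; exists x.
by rewrite leNgt cb.
Qed.

(** The supremum of the points up to which the segment stays in [U] can be
    neither in [U], by density, nor in [V]. *)
Lemma segment_not_split (x y : T) (U V : set T) : complete T ->
  densely_ordered T -> x <= y -> open U -> open V -> U x -> V y ->
  (forall z, x <= z <= y -> U z \/ V z) ->
  (forall z, x <= z <= y -> U z -> V z -> False) -> False.
Proof.
move=> cT dT xy oU oV Ux Vy cov disj.
have [s sP] := cT [set z | x <= z <= y /\ forall w, x <= w <= z -> U w].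
have xs : x <= s.
  apply: (proj2 (sP s) (lexx s)); split; first by rewrite lexx.
  by move=> w wx; rewrite -(le_anti wx).
have sy : s <= y by apply/sP => z [/andP[]].
have Ulow w : x <= w -> w < s -> U w.
  move=> xw ws; apply: contrapT => nUw; suff : s <= w by rewrite leNgt ws.
  apply/sP => z [/andP[xz zy] zU]; rewrite leNgt; apply/negP => wz.
  by apply: nUw; apply: zU; rewrite xw ltW.
have [|Us|Vs] := cov s; first by rewrite xs.
- have sy' : s < y.
    rewrite lt_neqAle sy andbT; apply/eqP => sEy.
    by apply: (disj s) => //; rewrite ?xs //; rewrite sEy.
  have [l [r [[ls sr] lrU]]] := nbhs_between (open_nbhs_nbhs (conj oU Us)).
  have [m [sm my mr]] : exists m, [/\ s < m, m <= y & oapp (fun b => m <= b) true r].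
    case: r {lrU} sr => [b|] /= sb; last by exists y.
    by exists (Order.min b y); split; rewrite ?lt_min ?ge_min ?sb ?lexx ?orbT.
  have [z /andP[sz zm]] := dT _ _ sm.
  suff : z <= s by rewrite leNgt sz.
  apply: (proj2 (sP s) (lexx s)); split.
    by rewrite (le_trans xs (ltW sz)) (le_trans (ltW zm)).
  move=> w /andP[xw wz]; have [ws|sw] := ltP w s; first exact: Ulow.
  apply: lrU; split.
    by case: l ls => //= a /lt_le_trans; apply.
  by case: r sr mr => //= b _ mb; exact: le_lt_trans (lt_le_trans zm mb).
- have xs' : x < s.
    rewrite lt_neqAle xs andbT; apply/eqP => xEs.
    by apply: (disj s) => //; rewrite ?xs //; rewrite -xEs.
  have [l [r [[ls sr] lrV]]] := nbhs_between (open_nbhs_nbhs (conj oV Vs)).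
  have [m [ms xm lm]] : exists m, [/\ m < s, x <= m & oapp (fun a => a <= m) true l].
    case: l {lrV} ls => [a|] /= sa; last by exists x.
    by exists (Order.max a x); split; rewrite ?gt_max ?le_max ?sa ?lexx ?orbT.
  have [z /andP[mz zs]] := dT _ _ ms.
  apply: (disj z).
  + by rewrite (le_trans xm (ltW mz)) (le_trans (ltW zs)).
  + by apply: Ulow => //; exact: le_trans (ltW mz).
  + apply: lrV; split.
      by case: l ls lm => //= a _ am; exact: le_lt_trans mz.
    by case: r sr => //= b; exact: lt_trans.
Qed.

Lemma segment_connected x y : complete T -> densely_ordered T ->
  connected [set z | x <= z <= y].
Proof.
move=> cT dT B [b Bb] [U oU BU] [V cV BV].
rewrite BU; apply/seteqP; split=> [z []//|p /= Ap]; split=> //.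
have := Bb; rewrite BU => -[/= Ab Ub]; have := Bb; rewrite BV => -[_ Vb].
apply: contrapT => nUp.
have nVp : ~ V p.
  by move=> Vp; have : B p; [rewrite BV | rewrite BU => -[]].
have UV z : x <= z <= y -> U z <-> V z.
  move=> Az; split=> [Uz|Vz].
    by have : B z; [rewrite BU | rewrite BV => -[]].
  by have : B z; [rewrite BV | rewrite BU => -[]].
have oV : open (~` V) by rewrite openC.
have sub u v z : x <= u <= y -> x <= v <= y -> u <= z <= v -> x <= z <= y.
  move=> /andP[xu _] /andP[_ vy] /andP[uz zv].
  by rewrite (le_trans xu uz) (le_trans zv vy).
have [bp|pb] := leP b p.
- apply: (segment_not_split cT dT bp oU oV) => // z /(sub _ _ _ Ab Ap) Az.
    by have [Vz|nVz] := pselect (V z); [left; apply/(UV z Az) | right].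
  by move=> /(UV z Az) Vz; apply.
- apply: (segment_not_split cT dT (ltW pb) oV oU) => // z /(sub _ _ _ Ap Ab) Az.
    by have [Vz|nVz] := pselect (V z); [right; apply/(UV z Az) | left].
  by move=> nV /(UV z Az).
Qed.

Lemma complete_connected : complete T -> densely_ordered T ->
  connected [set: T].
Proof.
move=> cT dT.
have [M MP] := cT setT; have [m mP] := cT set0.
have : connected [set z | m <= z <= M] by exact: segment_connected.
congr connected; apply/seteqP; split=> // z _ /=; apply/andP; split.
  exact: (proj1 (mP z)).
by apply: (proj2 (MP M)).
Qed.

Lemma connected_convex (A : set T) x y z : connected A -> A x -> A y ->
  x <= z <= y -> A z.
Proof.
move=> cA Ax Ay /andP[xz zy]; apply: contrapT => nAz.
have xz' : x < z by rewrite lt_neqAle xz andbT; apply/eqP => xEz; rewrite -xEz in nAz.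
suff : A `&` [set w | w < z] = A.
  move/seteqP => [_ /(_ y Ay)[_ /=]]; by rewrite ltNge zy.
apply: cA; first by exists x.
  by exists [set w | w < z] => //; have := lray_open z; rewrite set_itvE.
exists [set w | w <= z]; first by have := @lray_closed _ T z; rewrite set_itvE.
apply/seteqP; split=> w [Aw /= wz]; split=> //=; first exact: ltW.
by rewrite lt_neqAle wz andbT; apply/eqP => wEz; rewrite -wEz in nAz.
Qed.

End order_topology_facts.

Section embeddings.
Context {d d'} {X : orderTopologicalType d} {Y : orderTopologicalType d'}.
Hypotheses (cX : complete X) (dX : densely_ordered X).
Variable h : X -> Y.
Hypotheses (hcts : continuous h) (hinj : injective h).

(** The segment between [x] and [z] is connected, so its image contains every
    value between [h x] and [h z]; by injectivity [y] is in the segment. *)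
Let image_between x y z : h x < h y -> h y < h z -> x < y < z \/ z < y < x.
Proof.
move=> xy yz.
have key (a b : X) : a <= b -> connected (h @` [set w | a <= w <= b]).
  move=> ab; apply: connected_continuous_connected; first exact: segment_connected.
  exact: continuous_subspaceT.
have ne a b : h a < h b -> a != b by apply: contraTneq => ->; rewrite ltxx.
have := ne _ _ xy; have := ne _ _ yz => nyz nxy.
have [xz|zx] := leP x z.
- have [|||w wxz /hinj wy] :=
    connected_convex (x := h x) (y := h z) (z := h y) (key _ _ xz).
  + by exists x => //=; rewrite lexx.
  + by exists z => //=; rewrite xz lexx.
  + by rewrite !ltW.
  by left; move: wxz; rewrite /= wy !le_eqVlt (negPf nxy) (negPf nyz).
- have [|||w wxz /hinj wy] :=
    connected_convex (x := h x) (y := h z) (z := h y) (key _ _ (ltW zx)).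
  + by exists x => //=; rewrite lexx ltW.
  + by exists z => //=; rewrite lexx ltW.
  + by rewrite !ltW.
  right; move: wxz; rewrite /= wy !le_eqVlt eq_sym (negPf nyz) /=.
  by rewrite [y == x]eq_sym (negPf nxy).
Qed.

(** One of the three values lies between the other two, and
    [image_between] leaves only the value at the middle point. *)
Let between_image x y z : x < y -> y < z ->
  h x < h y < h z \/ h z < h y < h x.
Proof.
move=> xy yz; have xz := lt_trans xy yz.
have ne a b : a < b -> h a != h b.
  by move=> ab; apply/eqP => /hinj E; rewrite E ltxx in ab.
have asym a b : a < b -> b < a -> False.
  by move=> ab ba; move: (lt_trans ab ba); rewrite ltxx.
have [hxy|hyx|E] := ltgtP (h x) (h y); last by have := ne _ _ xy; rewrite E eqxx.
- have [hyz|hzy|E] := ltgtP (h y) (h z); [by left| |by have := ne _ _ yz; rewrite E eqxx].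
  have [hxz|hzx|E] := ltgtP (h x) (h z); last by have := ne _ _ xz; rewrite E eqxx.
    by case: (image_between hxz hzy) => /andP[/asym p /asym q];
      (by case: p) || (by case: q).
  by case: (image_between hzx hxy) => /andP[/asym p /asym q];
      (by case: p) || (by case: q).
- have [hyz|hzy|E] := ltgtP (h y) (h z); [|by right|by have := ne _ _ yz; rewrite E eqxx].
  have [hxz|hzx|E] := ltgtP (h x) (h z); last by have := ne _ _ xz; rewrite E eqxx.
    by case: (image_between hyx hxz) => /andP[/asym p /asym q];
      (by case: p) || (by case: q).
  by case: (image_between hyz hzx) => /andP[/asym p /asym q];
      (by case: p) || (by case: q).
Qed.

Lemma continuous_injective_monotone :
  {homo h : x y / x < y} \/ {homo h : x y / x < y >-> y < x}.
Proof.
have [m mP] := cX set0; have [M MP] := cX setT.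
have m_le x : m <= x by apply/mP.
have le_M x : x <= M by apply: (proj2 (MP M)).
have asym a b : h a < h b -> h b < h a -> False.
  by move=> ab ba; move: (lt_trans ab ba); rewrite ltxx.
have [hmM|hMm|/hinj mM] := ltgtP (h m) (h M); last first.
- left=> x y xy; have := le_lt_trans (m_le x) (lt_le_trans xy (le_M y)).
  by rewrite mM ltxx.
- have lowP x : m < x -> h x < h m.
    move=> mx; have := le_M x; rewrite le_eqVlt => /predU1P[->//|xM].
    have [/andP[hmx hxM]|/andP[]//] := between_image mx xM.
    by case: (asym m M (lt_trans hmx hxM) hMm).
  right=> x y xy; have := m_le x; rewrite le_eqVlt => /predU1P[mx|mx].
    by rewrite -mx; apply: lowP; rewrite mx.
  have [/andP[/asym]|/andP[]//] := between_image mx xy.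
  by move=> bad; case: bad; exact: lowP.
- have lowP x : m < x -> h m < h x.
    move=> mx; have := le_M x; rewrite le_eqVlt => /predU1P[->//|xM].
    have [/andP[]//|/andP[hMx hxm]] := between_image mx xM.
    by case: (asym m M hmM (lt_trans hMx hxm)).
  left=> x y xy; have := m_le x; rewrite le_eqVlt => /predU1P[mx|mx].
    by rewrite -mx; apply: lowP; rewrite mx.
  have [/andP[]//|/andP[_ /asym]] := between_image mx xy.
  by move=> bad; case: bad; exact: lowP.
Qed.
End embeddings.

Lemma embeddable_monotone d d' (X : orderTopologicalType d)
    (Y : orderTopologicalType d') :
  complete X -> densely_ordered X -> embeddable X Y ->
  exists h : X -> Y,
    (forall x z w, h x < w -> w < h z -> exists y, h y = w) /\
    ({homo h : x y / x < y} \/ {homo h : x y / x < y >-> y < x}).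
Proof.
move=> cX dX [A [f [g [fK gK fcts gcts]]]].
pose h x := val (f x).
have hinj : injective h by move=> x y /val_inj /(can_inj fK).
have hcts : continuous h.
  move=> x; apply: (@continuous_comp X (set_type A) Y f val); first exact: fcts.
  exact: initial_continuous.
exists h; split; last exact: continuous_injective_monotone.
move=> x z w xw wz.
have cR : connected (h @` [set: X]).
  apply: connected_continuous_connected; first exact: complete_connected.
  exact: continuous_subspaceT.
have [|||y _ <-] := connected_convex (x := h x) (y := h z) (z := w) cR; last by exists y.
- by exists x.
- by exists z.
- by rewrite !ltW.
Qed.

(** * Completeness of sums *)

Lemma well_ordered_complete d (T : orderType d) (M : T) :
  well_ordered T -> (forall x, x <= M) -> complete T.
Proof.
move=> wT Mtop P.
have [|s sP smin] := wT [set y | forall x, P x -> x <= y]; first by exists M.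
exists s => y; split=> [|sy x Px]; first exact: smin.
exact: le_trans (sP x Px) sy.
Qed.

Lemma well_ordered_jump d (T : orderType d) : well_ordered T ->
  forall x y : T, x < y -> jump x.
Proof.
move=> wT x y xy; have [|s xs smin] := wT [set z | x < z]; first by exists y.
exists s => // z /andP[xz zs]; have := smin z xz; by rewrite leNgt zs.
Qed.

Lemma le_cases d (T : orderType d) (x y : T) : x <= y -> x = y \/ x < y.
Proof. by rewrite le_eqVlt => /predU1P. Qed.

Section tlex_more.
Context {d d'} {I : orderType d} {F : orderType d'} {e : I -> bool}.
Local Notation T := (@tlex I F e).

Lemma tlex_leE (x y : T) : (x <= y) =
  (x.1 < y.1) || (x.1 == y.1) && (if e x.1 then x.2 <= y.2 else y.2 <= x.2).
Proof.
case: x y => [i u] [j v]; rewrite le_eqVlt tlex_ltE /= xpair_eqE.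
by case: ltgtP => //= ?; case: ifP => _; rewrite le_eqVlt // eq_sym.
Qed.

(** The supremum has as first coordinate the supremum [i] of the first
    coordinates.  In the fibre over [i] it is the bound of those points of [P]
    that lie there; when there are none, this is the least point of the
    fibre. *)
Lemma tlex_complete : complete I -> complete F -> complete T.
Proof.
move=> cI cF P.
have [i iP] := cI [set x.1 | x in P].
have i_ub x : P x -> x.1 <= i by move=> Px; apply: (proj2 (iP i)) => //; exists x.
have i_le (y : T) : (forall x, P x -> x <= y) -> i <= y.1.
  move=> yP; apply/iP => _ [x /yP + <-]; rewrite tlex_leE.
  by case/orP => [/ltW//|/andP[/eqP-> _]].
pose Pi := [set u | P (i, u)].
have [u uP] : exists u, forall y : T, y.1 = i ->
    (forall v, Pi v -> ((i, v) : T) <= y) <-> ((i, u) : T) <= y.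
  have [ei|ei] := boolP (e i).
    have [u uP] := cF Pi; exists u => -[_ w] /= ->.
    rewrite tlex_leE ltxx eqxx ei /=; split => H.
      by apply/uP => v /H; rewrite tlex_leE ltxx eqxx ei.
    by move=> v Pv; rewrite tlex_leE ltxx eqxx ei /=; apply: (proj2 (uP w)).
  have [u uP] := complete_inf cF Pi; exists u => -[_ w] /= ->.
  rewrite tlex_leE ltxx eqxx (negPf ei) /=; split => H.
    by apply/uP => v /H; rewrite tlex_leE ltxx eqxx (negPf ei).
  by move=> v Pv; rewrite tlex_leE ltxx eqxx (negPf ei) /=; apply: (proj2 (uP w)).
exists ((i, u) : T) => y; split=> [yP|uy x Px].
  have := i_le y yP; rewrite [i <= _]le_eqVlt => /predU1P[iy|iy].
    by apply/uP => // v /yP.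
  by rewrite tlex_leE iy.
have := i_ub x Px; rewrite [x.1 <= i]le_eqVlt => /predU1P[xi|xi]; last first.
  rewrite tlex_leE; move: uy; rewrite tlex_leE /= => /orP[iy|/andP[/eqP<- _]].
    by rewrite (lt_trans xi iy).
  by rewrite xi.
have := uy; rewrite tlex_leE /= => /orP[iy|/andP[/eqP iy _]].
  by rewrite tlex_leE xi iy.
have xE : x = (i, x.2) by rewrite -xi; case: (x).
apply: le_trans uy; rewrite xE; apply: (proj2 (uP (i, u) erefl)) => //.
by rewrite /Pi /= -xE.
Qed.
End tlex_more.

(** * Filling the jumps *)

(** For the relation [<] this means that the left cofinality of [x] is
    uncountable.  It fails for a least point and for a point with an immediate
    predecessor: take [C] empty or a singleton.  With a general relation [r],
    one definition serves the two sides of [x] and decreasing maps as well. *)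
Definition unreachable T (r : rel T) (x : T) :=
  forall C : set T, countable C -> (forall c, C c -> r c x) ->
  exists2 y, r y x & forall c, C c -> r c y.

Definition RR : realType := Rdefinitions.R.

(** A point [(s, t)] with [0 < t < 1] lies in the gap between [s] and its
    successor; the points [(s, 0)] form a copy of [S]. *)
Definition fillP d (S : orderType d) (x : @tlex S RR (fun=> true)) : bool :=
  (0 <= x.2 < 1)%R && ((x.2 == 0%R) || `[< jump x.1 >]).
Notation fill S := (suborder (@fillP _ S)).

Section fill.
Context {d} {S : orderType d}.
Implicit Types (s : S) (t : RR) (x y : fill S).

Lemma fill_ltE x y : (x < y) =
  ((val x).1 < (val y).1) || ((val x).1 == (val y).1) && ((val x).2 < (val y).2)%R.
Proof. by rewrite ltEsub tlex_ltE. Qed.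

Lemma fill_leE x y : (x <= y) =
  ((val x).1 < (val y).1) || ((val x).1 == (val y).1) && ((val x).2 <= (val y).2)%R.
Proof. by rewrite leEsub tlex_leE. Qed.

Lemma fill_ge0 x : (0 <= (val x).2)%R.
Proof. by case: x => y /= /andP[/andP[]]. Qed.
Lemma fill_lt1 x : ((val x).2 < 1)%R.
Proof. by case: x => y /= /andP[/andP[]]. Qed.
Lemma fill_jump x : (0 < (val x).2)%R -> jump (val x).1.
Proof.
by case: x => y /= /andP[_ /orP[/eqP->|/asboolP//]]; rewrite ltxx.
Qed.

Lemma fill0_subproof s : fillP ((s, 0%R) : @tlex S RR (fun=> true)).
Proof. by rewrite /fillP /= lexx ltr01 eqxx. Qed.
Definition fill0 s : fill S := exist (fun p => is_true (fillP p)) _ (fill0_subproof s).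

Lemma fill_point s t : jump s -> (0 <= t < 1)%R ->
  exists x, val x = (s, t).
Proof.
move=> js t01.
have H : fillP ((s, t) : @tlex S RR (fun=> true)).
  by rewrite /fillP t01; apply/orP; right; exact/asboolP.
by exists (exist (fun p => is_true (fillP p)) _ H).
Qed.

Lemma fill0_inj : injective fill0.
Proof. by move=> s s' /(congr1 val) []. Qed.

Lemma fill0_lt s s' : (fill0 s < fill0 s') = (s < s').
Proof. by rewrite fill_ltE /= ltxx andbF orbF. Qed.

(** If the second coordinates over the supremum [s] of the first coordinates
    tend to 1, then the supremum is the successor of [s], with coordinate 0. *)
Lemma fill_complete : complete S -> complete (fill S).
Proof.
move=> cS P.
have [s sP] := cS [set (val x).1 | x in P].
have s_ub x : P x -> (val x).1 <= s.
  by move=> Px; apply: (proj2 (sP s)) => //; exists x.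
have s_le y : (forall x, P x -> x <= y) -> s <= (val y).1.
  move=> yP; apply/sP => _ [x /yP + <-]; rewrite fill_leE.
  by case/orP => [/ltW//|/andP[/eqP-> _]].
have [[x0 Px0 x0s]|nS] := pselect (exists2 x, P x & (val x).1 = s); last first.
  exists (fill0 s) => y; split=> [/s_le|sy x Px].
    by move=> /le_cases[sy|sy]; rewrite fill_leE /= sy // eqxx fill_ge0 orbT.
  apply: le_trans sy; rewrite fill_leE /=.
  by have [xs|->//] := le_cases (s_ub x Px); case: nS; exists x.
pose T := [set t | exists2 x, P x & val x = (s, t)].
have T0 : T (val x0).2 by exists x0 => //; rewrite -x0s; case: (val x0).
have T_sup : has_sup T.
  split; first by exists (val x0).2.
  by exists 1%R => t [x _ xE]; have := fill_lt1 x; rewrite xE => /ltW.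
have T_ub t : T t -> (t <= sup T)%R by exact: (sup_upper_bound T_sup).
have T_le (r : RR) : (forall t, T t -> t <= r)%R -> (sup T <= r)%R.
  by move=> rT; apply: ge_sup => //; exists (val x0).2.
have sup0 : (0 <= sup T)%R by apply: le_trans (T_ub _ T0); exact: fill_ge0.
have sup_jump : (0 < sup T)%R -> jump s.
  move=> sp; apply: contrapT => nj; move: sp; rewrite ltNge => /negP; apply.
  apply: T_le => t [x _ xE]; rewrite leNgt; apply/negP => t0.
  by apply: nj; have := @fill_jump x; rewrite xE; apply.
have ub_sup y : (forall x, P x -> x <= y) -> (val y).1 = s -> (sup T <= (val y).2)%R.
  move=> yP ys; apply: T_le => t [x /yP]; rewrite fill_leE => + xE.
  by rewrite xE ys /= ltxx eqxx.
have [sup1|sup1] := ltP (sup T) 1%R.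
  have [z zE] : exists z : fill S, val z = (s, sup T).
    have [t0|t0] := ltP 0%R (sup T).
      by apply: fill_point; [exact: sup_jump | rewrite sup0].
    by exists (fill0 s); have -> : sup T = 0%R by apply/le_anti; rewrite t0.
  exists z => y; split=> [yP|zy x Px].
    rewrite fill_leE zE /=; have [sy|->//] := le_cases (s_le y yP).
    by rewrite -sy eqxx ub_sup ?orbT.
  apply: le_trans zy; rewrite fill_leE zE /=.
  have [xs|->//] := le_cases (s_ub x Px); rewrite xs eqxx ltxx /=.
  by apply: T_ub; exists x => //; rewrite -xs /=; case: (sval x).
have [s' ss' sjump] : jump s by apply: sup_jump; exact: lt_le_trans ltr01 sup1.
exists (fill0 s') => y; split=> [yP|sy x Px].
  have sy : s < (val y).1.
    rewrite lt_neqAle s_le // andbT; apply/eqP => sy.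
    by have := ub_sup y yP (esym sy); rewrite leNgt (lt_le_trans (fill_lt1 y)).
  have : s' <= (val y).1.
    by rewrite leNgt; apply/negP => ys'; apply: (sjump (val y).1); rewrite sy.
  by move=> /le_cases[sE|sE]; rewrite fill_leE /= sE // eqxx fill_ge0 orbT.
apply: le_trans sy; apply: ltW; rewrite fill_ltE /=.
by rewrite (le_lt_trans (s_ub x Px)).
Qed.

Let ratfiber s : set (fill S) :=
  [set x | (val x).1 = s /\ exists q : rat, (val x).2 = ratr q].

Let ratfiber_countable s : countable (ratfiber s).
Proof.
apply: (@sub_countable _ _ _ (range (ratr : rat -> RR))); last first.
  by apply: (card_le_trans (card_image_le _ _)); exact: countableP.
apply: (fun_card_le (f := fun x => (val x).2)) => [x [_ [q ->]]|x y [xs _] [ys _] xy].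
  by exists q.
by apply: val_inj; case: (val x) (val y) xs ys xy => [? ?] [? ?] /= -> -> ->.
Qed.

Let ratfiber_dense s (a b : RR) : jump s -> (0 <= a)%R -> (b <= 1)%R -> (a < b)%R ->
  exists x, [/\ ratfiber s x, (a < (val x).2)%R & ((val x).2 < b)%R].
Proof.
move=> js a0 b1 ab; have [q] := rat_in_itvoo ab; rewrite in_itv /= => /andP[aq qb].
have [|x xE] := fill_point (t := ratr q) js.
  by rewrite (le_trans a0 (ltW aq)) (lt_le_trans qb).
by exists x; rewrite /ratfiber /= xE /=; split => //; split => //; exists q.
Qed.

Definition rational_point x := exists q : rat, (val x).2 = ratr q.

Lemma fill_rational_dense x y : x < y -> exists2 z, rational_point z & x < z < y.
Proof.
rewrite fill_ltE => /orP[xy|/andP[/eqP xy txy]].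
  have [[s /andP[xs sy]]|nS] := pselect (exists s, (val x).1 < s < (val y).1).
    exists (fill0 s); first by exists 0%R; rewrite raddf0.
    by rewrite !fill_ltE /= xs sy.
  have jx : jump (val x).1.
    by exists (val y).1 => // z xzy; apply: nS; exists z.
  have [z [[zE zq] xz _]] := ratfiber_dense jx (fill_ge0 x) (lexx 1%R) (fill_lt1 x).
  by exists z => //; rewrite !fill_ltE zE eqxx xy xz orbT.
have jx : jump (val x).1.
  by rewrite xy; apply: fill_jump; exact: le_lt_trans (fill_ge0 x) txy.
have [z [[zE zq] xz zy]] := ratfiber_dense jx (fill_ge0 x) (ltW (fill_lt1 y)) txy.
by exists z => //; rewrite !fill_ltE zE xy eqxx -xy xz zy !orbT.
Qed.

Lemma fill_dense : densely_ordered (fill S).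
Proof. by move=> x y /fill_rational_dense[z _]; exists z. Qed.

Let sub_countableW (A B : set (fill S)) : A `<=` B -> countable B -> countable A.
Proof. by move=> AB; apply: sub_countable; exact: subset_card_le. Qed.

(** The points with a rational coordinate in a filled jump are countably many
    and dense there, so they approach every point inside the jump from both
    sides, and each of the two bounds of the jump from the inside.  On a side
    where a point of [S] does not bound a jump, the points of [S] come as close
    to it as those of the filled order. *)
Lemma fill_unreachable_lt x :
  unreachable <%O x <-> (val x).2 = 0%R /\ unreachable <%O (val x).1.
Proof.
split=> [xU|[x0 sU]].
  have x0 : (val x).2 = 0%R.
    apply/eqP; rewrite eq_le fill_ge0 andbT leNgt; apply/negP => tp.
    have js := fill_jump tp.
    have [||y yx yC] := xU [set y | ratfiber (val x).1 y /\ y < x].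
    - by apply: sub_countableW (ratfiber_countable (val x).1) => y [].
    - by move=> y [].
    have [w [wf _ wx]] := ratfiber_dense js (lexx 0%R) (ltW (fill_lt1 x)) tp.
    have wx' : w < x by case: wf => wE _; rewrite fill_ltE wE eqxx wx orbT.
    have yE : (val y).1 = (val x).1.
      have := yC w (conj wf wx'); case: wf => wE _; move: yx; rewrite !fill_ltE wE.
      by case: ltgtP.
    have yx2 : ((val y).2 < (val x).2)%R by move: yx; rewrite fill_ltE yE eqxx ltxx.
    have [v [vf yv vx]] := ratfiber_dense js (fill_ge0 y) (ltW (fill_lt1 x)) yx2.
    have vx' : v < x by case: vf => vE _; rewrite fill_ltE vE eqxx vx orbT.
    have := yC v (conj vf vx'); case: vf => vE _; rewrite fill_ltE vE yE ltxx eqxx /=.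
    by rewrite ltNge (ltW yv).
  split=> // C Cc Cs.
  have [||y yx yC] := xU (fill0 @` C).
  - exact: card_le_trans (card_image_le _ _) Cc.
  - by move=> _ [c Cc' <-]; rewrite fill_ltE /= Cs.
  have ys : (val y).1 < (val x).1.
    by move: yx; rewrite fill_ltE x0 (ltNge _ 0%R) fill_ge0 andbF orbF.
  have Cy c : C c -> c <= (val y).1.
    move=> Cc'; have /(_ (ex_intro2 _ _ c Cc' erefl)) := yC (fill0 c).
    by rewrite fill_ltE /= => /orP[/ltW//|/andP[/eqP->]].
  have [[z /andP[yz zx]]|nz] := pselect (exists z, (val y).1 < z < (val x).1).
    by exists z => // c /Cy cy; exact: le_lt_trans yz.
  have js : jump (val y).1.
    by exists (val x).1 => // z xzy; apply: nz; exists z.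
  (* Otherwise [x] is the right end of a jump, whose rational points approach
     it. *)
  have [|z zx zC] := xU (ratfiber (val y).1) (ratfiber_countable _).
    by move=> c [cE _]; rewrite fill_ltE cE ys.
  have zs : (val z).1 < (val x).1.
    by move: zx; rewrite fill_ltE x0 (ltNge _ 0%R) fill_ge0 andbF orbF.
  have yz : (val y).1 <= (val z).1.
    have [w [wf _ _]] := ratfiber_dense js (lexx 0%R) (lexx 1%R) ltr01.
    have := zC w wf; case: wf => wE _; rewrite fill_ltE wE => /orP[/ltW//|/andP[/eqP->]//].
  have {}yz : (val z).1 = (val y).1.
    apply/eqP; rewrite eq_le yz andbT leNgt; apply/negP => yz'.
    by apply: nz; exists (val z).1; rewrite yz'.
  have [w [wf zw _]] := ratfiber_dense js (fill_ge0 z) (lexx 1%R) (fill_lt1 z).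
  have := zC w wf; case: wf => wE _; rewrite fill_ltE wE yz ltxx eqxx /=.
  by rewrite ltNge (ltW zw).
move=> C Cc Cx.
have lt1 c : C c -> (val c).1 < (val x).1.
  by move=> /Cx; rewrite fill_ltE x0 (ltNge _ 0%R) fill_ge0 andbF orbF.
have [||s sx sC] := sU [set (val c).1 | c in C].
- exact: card_le_trans (card_image_le _ _) Cc.
- by move=> _ [c /lt1 cx <-].
exists (fill0 s); first by rewrite fill_ltE /= sx.
by move=> c Cc'; rewrite fill_ltE /= sC //; exists c.
Qed.

Lemma fill_unreachable_gt x :
  unreachable (fun x y => y < x) x <->
  (val x).2 = 0%R /\ unreachable (fun s s' => s' < s) (val x).1.
Proof.
have nojump y : unreachable (fun x y => y < x) y -> ~ jump (val y).1.
  move=> yU js; have [s' ss' sjump] := js.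
  have [||z yz zC] := yU [set z | ratfiber (val y).1 z /\ y < z].
  - by apply: sub_countableW (ratfiber_countable (val y).1) => z [].
  - by move=> z [].
  have y1 := fill_lt1 y.
  have [w [wf yw _]] := ratfiber_dense js (fill_ge0 y) (lexx 1%R) y1.
  have wy' : y < w by case: wf => wE _; rewrite fill_ltE wE eqxx yw orbT.
  have zE : (val z).1 = (val y).1.
    have := zC w (conj wf wy'); case: wf => wE _; move: yz; rewrite !fill_ltE wE.
    by case: ltgtP.
  have yz2 : ((val y).2 < (val z).2)%R by move: yz; rewrite fill_ltE zE eqxx ltxx.
  have [v [vf yv vz]] := ratfiber_dense js (fill_ge0 y) (ltW (fill_lt1 z)) yz2.
  have vy' : y < v by case: vf => vE _; rewrite fill_ltE vE eqxx yv orbT.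
  have := zC v (conj vf vy'); case: vf => vE _; rewrite fill_ltE vE zE ltxx eqxx /=.
  by rewrite ltNge (ltW vz).
split=> [xU|[x0 sU]].
  have nj := nojump x xU.
  have fiber0 y : (val y).1 = (val x).1 -> (val y).2 = 0%R.
    move=> yE; apply/eqP; rewrite eq_le fill_ge0 andbT leNgt; apply/negP => tp.
    by apply: nj; rewrite -yE; exact: fill_jump.
  have x0 := fiber0 x erefl.
  have gtE y : x < y -> (val x).1 < (val y).1.
    rewrite fill_ltE => /orP[//|/andP[/eqP /esym/fiber0 ->]].
    by rewrite x0 ltxx.
  split=> // C Cc Cs.
  have [||y xy yC] := xU (fill0 @` C).
  - exact: card_le_trans (card_image_le _ _) Cc.
  - by move=> _ [c Cc' <-]; rewrite fill_ltE /= Cs.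
  exists (val y).1; first exact: gtE.
  move=> c Cc'; have /(_ (ex_intro2 _ _ c Cc' erefl)) := yC (fill0 c).
  by rewrite fill_ltE /= (ltNge _ 0%R) fill_ge0 andbF orbF.
have nj : ~ jump (val x).1.
  move=> [s' ss' sjump]; have [||z sz zC] := sU [set s'].
  - exact: countable1.
  - by move=> _ ->.
  by apply: (sjump z); rewrite sz zC.
have gtE y : x < y -> (val x).1 < (val y).1.
  rewrite fill_ltE => /orP[//|/andP[/eqP xy]]; rewrite x0 => tp.
  by case: nj; rewrite xy; exact: fill_jump.
move=> C Cc Cx.
have [||s sx sC] := sU [set (val c).1 | c in C].
- exact: card_le_trans (card_image_le _ _) Cc.
- by move=> _ [c /Cx/gtE cx <-].
exists (fill0 s); first by rewrite fill_ltE /= sx.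
by move=> c Cc'; rewrite fill_ltE /= sC //; exists c.
Qed.
End fill.

(** * The approach to the points of a sum of copies of omega_1 + 1 *)

Section blocks.
Context {d d'} {J : orderType d} {U : orderType d'} {e : J -> bool}.
Variables (oo : U).
Hypotheses (wJ : well_ordered J) (wU : well_ordered U).
(* These three hypotheses say that [U] is a copy of omega_1 + 1, with point at
   infinity [oo]. *)
Hypotheses (oo_top : forall u, u <= oo)
  (oo_small : forall u, u < oo -> countable [set v | v <= u])
  (oo_large : ~ countable [set v | v < oo]).
(* The first point of a block in natural order at a limit position could have
   uncountable cofinality without being the mark of its block. *)
Hypothesis e_succ : forall j, e j -> exists2 i, i < j & forall k, ~ (i < k < j).
Local Notation S := (@tlex J U e).
Implicit Types (i j k : J) (u v w : U) (C : set S).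

Local Notation pt j u := ((j, u) : S).

Let pt_lt i j u v : (pt i u < pt j v) =
  (i < j) || (i == j) && (if e i then u < v else v < u).
Proof. by rewrite tlex_ltE. Qed.

(** The regularity of omega_1. *)
Let countable_below_bounded (C : set U) : countable C ->
  exists2 u, u < oo & forall c, C c -> c < oo -> c < u.
Proof.
move=> Cc; apply: contrapT => nu; apply: oo_large.
pose B := \bigcup_(c in C `&` [set c | c < oo]) [set v | v <= c].
have : countable B.
  apply: bigcup_countable => [|c [_ coo]]; last exact: oo_small.
  by apply: sub_countable Cc; apply: subset_card_le => c [].
apply: sub_countable; apply: subset_card_le => u /= uoo.
apply: contrapT => nB; apply: nu; exists u => // c Cc' coo.
by rewrite ltNge; apply/negP => uc; apply: nB; exists c.
Qed.

Let fiber_countable j C : countable C -> countable [set u | C (pt j u)].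
Proof.
by apply: sub_countable; apply: (fun_card_le (f := fun u => pt j u)) => [//|u v _ _ []].
Qed.

Lemma block_top_unreachable_lt j : e j -> unreachable <%O (pt j oo).
Proof.
move=> ej C Cc Cj.
have [u uoo uC] := countable_below_bounded (@fiber_countable j C Cc).
exists (pt j u); first by rewrite pt_lt eqxx ej uoo orbT.
move=> [i v] Civ; have := Cj _ Civ; rewrite !pt_lt => /orP[->//|/andP[/eqP ij]].
by subst i; rewrite ej eqxx ltxx /=; exact: uC.
Qed.

Lemma block_top_unreachable_gt j : ~~ e j -> unreachable (fun s s' => s' < s) (pt j oo).
Proof.
move=> ej C Cc Cj.
have [u uoo uC] := countable_below_bounded (@fiber_countable j C Cc).
exists (pt j u); first by rewrite pt_lt eqxx (negPf ej) uoo orbT.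
move=> [i v] Civ; have := Cj _ Civ; rewrite !pt_lt => /orP[->//|/andP[/eqP ij]].
by subst i; rewrite (negPf ej) eqxx ltxx /=; exact: uC.
Qed.

Let succU u : u != oo -> exists2 v, u < v & forall w, ~ (u < w < v).
Proof.
move=> uoo; apply: (well_ordered_jump wU (y := oo)).
by rewrite lt_neqAle uoo oo_top.
Qed.

Let minU : exists u0, forall u, u0 <= u.
Proof.
have [|u0 _ u0min] := wU (P := setT); first by exists oo.
by exists u0 => u; exact: u0min.
Qed.

Let block_max j : exists u, forall v, pt j v <= pt j u.
Proof.
have [u0 u0min] := minU; have [ej|ej] := boolP (e j).
  by exists oo => v; rewrite tlex_leE /= eqxx ej oo_top orbT.
by exists u0 => v; rewrite tlex_leE /= eqxx (negPf ej) u0min orbT.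
Qed.

Let block_min j : exists u, forall v, pt j u <= pt j v.
Proof.
have [u0 u0min] := minU; have [ej|ej] := boolP (e j).
  by exists u0 => v; rewrite tlex_leE /= eqxx ej u0min orbT.
by exists oo => v; rewrite tlex_leE /= eqxx (negPf ej) oo_top orbT.
Qed.

Let below_countable j u : u != oo -> countable [set s : S | s.1 = j /\ s.2 < u].
Proof.
move=> uoo; have : countable [set v | v <= u].
  by apply: oo_small; rewrite lt_neqAle uoo oo_top.
apply: sub_countable; apply: (fun_card_le (f := snd)).
  by move=> s [_ /ltW].
by move=> [i v] [j' w] [/= -> _] [/= -> _] ->.
Qed.

(** A point other than [oo] has countably many predecessors and an immediate
    successor in [U], so within its block it is approached from both sides,
    except where it is an end of the block.  The first point of a block in
    natural order is preceded by the last point of the previous block, which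
    exists by [e_succ]. *)
Lemma unreachable_lt_block j u : unreachable <%O (pt j u) -> u = oo.
Proof.
move=> ju; apply/eqP; apply: contrapT => /negP uoo.
have [ej|ej] := boolP (e j); last first.
  have [v uv vnext] := succU uoo.
  have [||[k w] kwj /(_ _ erefl)] := ju [set pt j v]; first exact: countable1.
    by move=> _ ->; rewrite pt_lt eqxx (negPf ej) uv orbT.
  move: kwj; rewrite !pt_lt => /orP[kj|/andP[/eqP-> uw]].
    by rewrite (gt_eqF kj) (lt_gtF kj).
  move: uw; rewrite eqxx ltxx (negPf ej) /= => uw wv.
  by apply: (vnext w); rewrite uw.
have [[v vu]|nv] := pselect (exists v, v < u).
  have [|[k w] kwj kwC] := ju _ (@below_countable j u uoo).
    by move=> [i w] [/= -> wu]; rewrite pt_lt eqxx ej wu orbT.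
  have := kwC (pt j v) (conj erefl vu).
  move: kwj; rewrite !pt_lt => /orP[kj|/andP[/eqP kj]].
    by rewrite (gt_eqF kj) (lt_gtF kj).
  subst k; rewrite ej => wu _.
  by have := kwC (pt j w) (conj erefl wu); rewrite ltxx.
have [i ij inext] := e_succ ej; have [m mmax] := block_max i.
have [||[k w] kwj /(_ _ erefl)] := ju [set pt i m]; first exact: countable1.
  by move=> _ ->; rewrite pt_lt ij.
rewrite pt_lt => /orP[ik|/andP[/eqP ik]].
  move: kwj; rewrite pt_lt => /orP[kj|/andP[/eqP kj]].
    by apply: (inext k); rewrite ik.
  by rewrite kj ej => wu; apply: nv; exists w.
have := mmax w; rewrite leNgt pt_lt eqxx ltxx /= => /negP nm.
by move=> mw; apply: nm; move: mw.
Qed.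

(** Every position but the last has an immediate successor, so the last point
    of a block is followed by the first point of the next block, or it is the
    last point of all.  This applies to the point [oo] of a block in natural
    order. *)
Lemma unreachable_gt_block j u :
  unreachable (fun s s' => s' < s) (pt j u) -> u = oo /\ ~~ e j.
Proof.
move=> ju.
have notmax : exists v, pt j u < pt j v.
  apply: contrapT => nv.
  have umax v : pt j v <= pt j u by rewrite leNgt; apply/negP => uv; apply: nv; exists v.
  have above k w : pt j u < pt k w -> j < k.
    move=> uk; rewrite ltNge; apply/negP => /le_cases[kj|kj].
      by subst k; move: uk; rewrite ltNge umax.
    by move: uk; rewrite pt_lt (gt_eqF kj) (lt_gtF kj).
  have [j' jj' jnext] : exists2 j', j < j' & forall k, ~ (j < k < j').
    have [||[k w] /above jk _] := ju set0 => //.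
    exact: well_ordered_jump jk.
  have [m mmin] := block_min j'.
  have [||[k w] /above jk /(_ _ erefl)] := ju [set pt j' m]; first exact: countable1.
    by move=> _ ->; rewrite pt_lt jj'.
  rewrite pt_lt => /orP[kj|/andP[/eqP kj]].
    by apply: (jnext k); rewrite jk.
  by subst k; have := mmin w; rewrite leNgt pt_lt eqxx ltxx /= => /negP.
have [ej|ej] := boolP (e j).
  have uoo : u != oo.
    case: notmax => v; rewrite pt_lt eqxx ltxx ej /=; apply: contraTneq => ->.
    by rewrite -leNgt oo_top.
  have [v uv vnext] := succU uoo.
  have [||[k w] kwj /(_ _ erefl)] := ju [set pt j v]; first exact: countable1.
    by move=> _ ->; rewrite pt_lt eqxx ej uv orbT.
  move: kwj; rewrite !pt_lt => /orP[kj|/andP[/eqP<- uw]].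
    by rewrite (gt_eqF kj) (lt_gtF kj).
  move: uw; rewrite eqxx ltxx ej /= => uw wv.
  by case: (vnext w); rewrite uw.
split=> //; apply/eqP; apply: contrapT => /negP uoo.
have [v vu] : exists v, v < u.
  by case: notmax => v; rewrite pt_lt eqxx ltxx (negPf ej) /=; exists v.
have [|[k w] kwj kwC] := ju _ (@below_countable j u uoo).
  by move=> [i w] [/= -> wu]; rewrite pt_lt eqxx (negPf ej) wu orbT.
have := kwC (pt j v) (conj erefl vu).
move: kwj; rewrite !pt_lt => /orP[kj|/andP[/eqP kj]].
  by rewrite (gt_eqF kj) (lt_gtF kj).
subst k; rewrite (negPf ej) => wu _.
by have := kwC (pt j w) (conj erefl wu); rewrite ltxx.
Qed.
End blocks.

(** * From embeddings to words *)

Section transfer.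
Context {X Y : Type} (r : rel X) (r' : rel Y) (h : X -> Y).
Hypotheses (hr : forall x y, r' (h x) (h y) = r x y) (hinj : injective h).
Hypotheses (r_trans : transitive r) (r'_trans : transitive r').
Hypothesis r'_total : forall a b, r' a b \/ a = b \/ r' b a.
Hypothesis h_convex : forall x z w, r' (h x) w -> r' w (h z) -> exists y, h y = w.

(** Only the part of a countable set that lies between a fixed value [h y0] and
    [h x] matters, and this part is in the image of [h]. *)
Lemma unreachable_image x : unreachable r x -> unreachable r' (h x).
Proof.
move=> xU C Cc Cx.
have [y0 y0x _] := xU set0 (@countable0 _) (fun _ => False_ind _).
have [||y1 y1x y1C] := xU [set z | C (h z) /\ r z x].
- by apply: sub_countable Cc; apply: (fun_card_le (f := h)) => [z []|z w _ _ /hinj].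
- by move=> z [].
have [||y yx yy] := xU [set y0; y1]; first exact/finite_set_countable/finite_set2.
  by move=> _ [->|->].
have y0y : r y0 y by apply: yy; left.
have y1y : r y1 y by apply: yy; right.
exists (h y); first by rewrite hr.
move=> c Cc'; have [cy0|[->|y0c]] := r'_total c (h y0).
- by apply: r'_trans cy0 _; rewrite hr.
- by rewrite hr.
have [z zc] := h_convex y0c (Cx _ Cc').
rewrite -zc hr; apply: r_trans (y1C z _) y1y; split; first by rewrite zc.
by rewrite -hr zc; exact: Cx.
Qed.

(** If no point were before [x], all the points before [h x] would be outside
    of the image of [h] and would say nothing about [x]. *)
Lemma unreachable_preimage x y0 : r y0 x -> unreachable r' (h x) -> unreachable r x.
Proof.
move=> y0x hxU C Cc Cx.
have [||w1 w1x w1C] := hxU (h @` C).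
- exact: card_le_trans (card_image_le _ _) Cc.
- by move=> _ [c /Cx cx <-]; rewrite hr.
have [||w wx ww] := hxU [set h y0; w1]; first exact/finite_set_countable/finite_set2.
  by move=> _ [->|->] //; rewrite hr.
have y0w : r' (h y0) w by apply: ww; left.
have w1w : r' w1 w by apply: ww; right.
have [y yw] := h_convex y0w wx.
exists y; first by rewrite -hr yw.
by move=> c Cc'; rewrite -hr yw; apply: r'_trans w1w; apply: w1C; exists c.
Qed.
End transfer.

Section word_embedding.
Context {d1 d2 d3 d4} {J : orderType d1} {J' : orderType d2}
  {X : orderType d3} {Y : orderType d4}.
Context (e : J -> bool) (e' : J' -> bool) (p : J -> X) (p' : J' -> Y).
Hypotheses (p_lt : forall i j, (p i < p j) = (i < j))
           (p'_lt : forall i j, (p' i < p' j) = (i < j)).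
Hypotheses
  (p_left : forall j, e j -> unreachable <%O (p j))
  (p_right : forall j, ~~ e j -> unreachable (fun x y => y < x) (p j))
  (left_p : forall x, unreachable <%O x -> exists j, x = p j)
  (right_p : forall x, unreachable (fun x y => y < x) x -> exists2 j, x = p j & ~~ e j).
Hypotheses
  (p'_left : forall j, e' j -> unreachable <%O (p' j))
  (p'_right : forall j, ~~ e' j -> unreachable (fun x y => y < x) (p' j))
  (left_p' : forall x, unreachable <%O x -> exists j, x = p' j)
  (right_p' : forall x, unreachable (fun x y => y < x) x -> exists2 j, x = p' j & ~~ e' j).
Hypotheses (wJ' : well_ordered J').
Variable s : nat -> J.
Hypothesis s_lt : forall n, s n < s n.+1.
Variable h : X -> Y.
Hypothesis h_convex : forall x z w, h x < w -> w < h z -> exists y, h y = w.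

Let total_lt {d} {T : orderType d} (a b : T) : a < b \/ a = b \/ b < a.
Proof. by case: ltgtP => [ab|ba|ab]; [left|right; right|right; left]. Qed.
Let total_gt {d} {T : orderType d} (a b : T) : b < a \/ a = b \/ a < b.
Proof. by case: (ltgtP a b) => [ab|ba|ab]; [right; right|left|right; left]. Qed.
Let trans_lt {d} {T : orderType d} : transitive (fun x y : T => x < y).
Proof. exact: lt_trans. Qed.
Let trans_gt {d} {T : orderType d} : transitive (fun x y : T => y < x).
Proof. by move=> y x z yx zy; exact: lt_trans yx. Qed.

Let p'_inj : injective p'.
Proof.
move=> i j ij; have [ij'|ji|//] := ltgtP i j.
  by move: ij'; rewrite -p'_lt ij ltxx.
by move: ji; rewrite -p'_lt ij ltxx.
Qed.

(** A decreasing map sends marks to marks and thus reverses the sequence [s],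
    which gives an infinite descent among the positions [J']. *)
Lemma not_decreasing : {homo h : x y / x < y >-> y < x} -> False.
Proof.
move=> hdec.
have hr x y : (h y < h x) = (x < y).
  have [/hdec//|/hdec hyx|->] := ltgtP x y; last by rewrite ltxx.
  by rewrite (lt_gtF hyx).
have hinj : injective h.
  by move=> x y E; have [/hdec|/hdec|//] := ltgtP x y; rewrite E ltxx.
have [g gE] : {g & forall j, h (p j) = p' (g j)}.
  apply: (boolp.choice (P := fun j i => h (p j) = p' i)) => j; have [ej|ej] := boolP (e j).
    have [|i hi _] := right_p' (x := h (p j)); last by exists i.
    apply: (unreachable_image (r := <%O) hr hinj trans_lt trans_gt) (p_left ej).
      exact: total_gt.
    by move=> x z w wx zw; exact: h_convex zw wx.
  have [|i hi] := left_p' (x := h (p j)); last by exists i.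
  apply: (unreachable_image (r := fun x y => y < x) _ hinj trans_gt trans_lt) (p_right ej).
  - by move=> x y; exact: hr.
  - exact: total_lt.
  - exact: h_convex.
have [|_ [n _ <-] nmin] := wJ' (P := range (g \o s)); first by exists (g (s 0%N)), 0%N.
have := nmin (g (s n.+1)) (ex_intro2 _ _ n.+1 I erefl); rewrite leNgt => /negP; apply.
by rewrite /= -p'_lt -!gE hr p_lt.
Qed.

(** The letter at the last position may change: if it is true, its mark can be
    the last point of [X], and the right side of the image is then
    unconstrained. *)
Lemma word_embedding : {homo h : x y / x < y} ->
  exists g : J -> J',
  [/\ forall i j, i < j -> g i < g j,
      forall i j k', g i < k' < g j -> exists k, g k = k' &
      forall i j, i < j -> e' (g i) = e i].
Proof.
move=> hinc.
have hr x y : (h x < h y) = (x < y).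
  have [/hinc//|/hinc hyx|->] := ltgtP x y; last by rewrite ltxx.
  by rewrite (lt_gtF hyx).
have hr' x y : (h y < h x) = (y < x) by exact: hr.
have hinj : injective h.
  by move=> x y E; have [/hinc|/hinc|//] := ltgtP x y; rewrite E ltxx.
have h_convex' x z w : w < h x -> h z < w -> exists y, h y = w.
  by move=> wx zw; exact: h_convex zw wx.
have img_left x :=
  unreachable_image (x := x) hr hinj trans_lt trans_lt (@total_lt _ _) h_convex.
have img_right x :=
  unreachable_image (x := x) hr' hinj trans_gt trans_gt (@total_gt _ _) h_convex'.
have pre_left x y := unreachable_preimage (x := x) (y0 := y) hr trans_lt h_convex.
have pre_right x y := unreachable_preimage (x := x) (y0 := y) hr' trans_gt h_convex'.
have [g gE] : {g & forall j, h (p j) = p' (g j)}.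
  apply: (boolp.choice (P := fun j i => h (p j) = p' i)) => j.
  have [/p_left/img_left/left_p'//|] := boolP (e j).
  by move=> /p_right/img_right/right_p'[i]; exists i.
exists g; split.
- by move=> i j ij; rewrite -p'_lt -!gE hr p_lt.
- move=> i j k' /andP[ik kj].
  have [x hx] : exists x, h x = p' k'.
    by apply: (h_convex (x := p i) (z := p j)); rewrite gE p'_lt.
  have [ix xj] : p i < x /\ x < p j by rewrite -!hr hx !gE !p'_lt.
  suff [k xk] : exists k, x = p k by exists k; apply: p'_inj; rewrite -gE -xk.
  have [/p'_left|/p'_right] := boolP (e' k'); rewrite -hx.
    by move=> /(pre_left _ _ ix)/left_p.
  by move=> /(pre_right _ _ xj)/right_p[k]; exists k.
- move=> i j ij; have [ei|ei] := boolP (e i); last first.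
    by have [k] := right_p' (img_right _ (p_right ei)); rewrite gE => /p'_inj -> /negPf.
  apply: contrapT => /negP e'i.
  have : unreachable (fun x y => y < x) (h (p i)) by rewrite gE; exact: p'_right.
  have pij : p i < p j by rewrite p_lt.
  move=> /(pre_right _ _ pij)/right_p[k pik].
  suff -> : k = i by rewrite ei.
  have [ki|ik|//] := ltgtP k i; first by move: ki; rewrite -p_lt -pik ltxx.
  by move: ik; rewrite -p_lt -pik ltxx.
Qed.
End word_embedding.

(** * Rigidity of the coding words *)

Definition positions (K : Type) : orderType (Order.Disp tt tt) :=
  with_last (@tlex (with_last (WO K)) nat (fun=> true)).

Definition pos K (w : with_last (WO K)) (n : nat) : positions K := Some (w, n).
Definition last_pos K : positions K := None.

Definition extremal d (T : porderType d) (w : T) :=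
  (forall w', w <= w') \/ (forall w', w' <= w).

(** The bit for [k] is letter 4 of its block.  Letter 0 is false because it may
    stand at a limit position, and letter 3 is false so that the bit does not
    extend the pair of letters 1 and 2 that marks the two extremal blocks. *)
Definition word K (A : set K) (j : positions K) : bool :=
  if j is Some (w, n) then
    ((n == 1%N) || (n == 2%N)) && `[< extremal w >] ||
    (n == 4%N) && (if w is Some k then `[< A k >] else false)
  else false.

Section positions.
Context {K : Type}.
Implicit Types (w : with_last (WO K)) (n : nat) (i j : positions K).

Lemma positions_well_ordered : well_ordered (positions K).
Proof.
apply: with_last_well_ordered; apply: tlex_well_ordered; last exact: nat_well_ordered.
by apply: with_last_well_ordered; exact: WO_well_ordered.
Qed.

Lemma positions_le_last j : j <= last_pos K.
Proof. exact: with_last_leN. Qed.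

Lemma pos_lt w n w' n' :
  (pos w n < pos w' n') = (w < w') || (w == w') && (n < n')%N.
Proof. by rewrite /pos with_last_ltS tlex_ltE. Qed.

Lemma pos_lt_last w n : pos w n < last_pos K.
Proof. exact: with_last_ltSN. Qed.

Lemma pos_next w n j : pos w n < j -> pos w n.+1 <= j.
Proof.
case: j => [[w' n']|] lt; last exact: with_last_leN.
rewrite leNgt -[Some _]/(pos w' n') pos_lt; move: lt; rewrite -[Some _]/(pos w' n') pos_lt.
by case: ltgtP => //= _; rewrite -leqNgt.
Qed.

Lemma pos_adjacent w n j : ~ (pos w n < j < pos w n.+1).
Proof. by move=> /andP[/pos_next]; rewrite leNgt => /negPf->. Qed.

Lemma word_succ (A : set K) j : word A j ->
  exists2 i, i < j & forall k, ~ (i < k < j).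
Proof.
case: j => [[w [|n]]|] //= _; exists (pos w n); last exact: pos_adjacent.
by rewrite -[Some _]/(pos w n.+1) pos_lt eqxx ltnSn orbT.
Qed.

Lemma word_pos (A : set K) w n : word A (pos w n) =
  ((n == 1%N) || (n == 2%N)) && `[< extremal w >] ||
    (n == 4%N) && (if w is Some k then `[< A k >] else false).
Proof. by []. Qed.

Lemma word_bit (A : set K) k : word A (pos (Some k) 4) = `[< A k >].
Proof. by []. Qed.

Lemma word_pair (A : set K) w n :
  word A (pos w n) -> word A (pos w n.+1) -> n = 1%N /\ extremal w.
Proof. by case: n => [|[|[|[|[|n]]]]] //= /orP[/asboolP|]. Qed.

Lemma extremal_word (A : set K) w n : extremal w -> (n == 1%N) || (n == 2%N) ->
  word A (pos w n).
Proof. by move=> wx n12; rewrite word_pos n12 /=; apply/orP; left; exact/asboolP. Qed.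

Lemma extremal_last : extremal (None : with_last (WO K)).
Proof. by right => w; exact: with_last_leN. Qed.

Lemma exists_first (k : K) : exists w, forall w', w <= w'.
Proof.
have [|w _ wmin] := with_last_well_ordered (@WO_well_ordered K) (P := setT).
  by exists None.
by exists w => w'; exact: wmin.
Qed.

Lemma extremal_eq w0 w : (forall w', w0 <= w') -> extremal w -> w = w0 \/ w = None.
Proof.
move=> w0min [wmin|wmax]; [left|right]; apply: le_anti.
  by rewrite wmin w0min.
by rewrite wmax andbT; exact: with_last_leN.
Qed.
End positions.

Section word_rigidity.
Context {K K' : Type} (A : set K) (A' : set K').
Context (g : positions K -> positions K').
Hypotheses (g_lt : forall i j, i < j -> g i < g j)
  (g_convex : forall i j k', g i < k' < g j -> exists k, g k = k')
  (g_word : forall i j, i < j -> word A' (g i) = word A i).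

Let g_ltE i j : (g i < g j) = (i < j).
Proof.
have [/g_lt//|/g_lt ji|->] := ltgtP i j; last by rewrite ltxx.
by rewrite (lt_gtF ji).
Qed.

(** The map [g] preserves adjacency because its image is convex, and two
    adjacent letters true occur only in extremal blocks. *)
Lemma extremal_image w : extremal w ->
  exists2 w', g (pos w 1) = pos w' 1 & extremal w'.
Proof.
move=> wx.
have e1 : word A' (g (pos w 1)).
  by rewrite (g_word (pos_lt_last _ _)); exact: extremal_word.
have e2 : word A' (g (pos w 2)).
  by rewrite (g_word (pos_lt_last _ _)); exact: extremal_word.
have lt12 : g (pos w 1) < g (pos w 2) by rewrite g_ltE pos_lt eqxx orbT.
case E : (g (pos w 1)) e1 => [[w' n]|//] e1.
have {}E : g (pos w 1) = pos w' n by [].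
have E2 : pos w' n.+1 = g (pos w 2).
  have := @pos_next _ w' n (g (pos w 2)); rewrite -E => /(_ lt12).
  case/le_cases => // lt.
  have [|k kE] := g_convex (i := pos w 1) (j := pos w 2) (k' := pos w' n.+1).
    by rewrite lt E pos_lt eqxx ltnSn orbT.
  exfalso; apply: (@pos_adjacent _ w 1 k); rewrite -!g_ltE kE lt E.
  by rewrite pos_lt eqxx ltnSn orbT.
have [n1 w'x] := word_pair (A := A') e1 (etrans (congr1 _ E2) e2).
by exists w' => //; rewrite n1.
Qed.

Variables (w0 : with_last (WO K)) (w0' : with_last (WO K')).
Hypotheses (w0_min : forall w, w0 <= w) (w0'_min : forall w, w0' <= w).

Variable k0 : K.

Let first_lt (w : with_last (WO K)) k : w <= Some k -> w < None.
Proof. by move=> wk; apply: le_lt_trans wk _; exact: with_last_ltSN. Qed.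

Lemma ends_image : g (pos w0 1) = pos w0' 1 /\ g (pos None 1) = pos None 1.
Proof.
have [w gw wx] := extremal_image (or_introl w0_min).
have [v gv vx] := extremal_image (@extremal_last K).
have wv : w < v.
  have : g (pos w0 1) < g (pos None 1).
    by rewrite g_ltE pos_lt (first_lt (w0_min (Some k0))).
  by rewrite gw gv pos_lt ltnn andbF orbF.
rewrite gw gv; have [vE|->] := extremal_eq w0'_min vx.
  by have := w0'_min w; rewrite leNgt -vE wv.
have [->//|wE] := extremal_eq w0'_min wx.
by have := with_last_leN v; rewrite leNgt -wE wv.
Qed.

Lemma bit_preimage (k' : K') : exists j, g j = pos (Some k') 4.
Proof.
have [g0 g1] := ends_image.
apply: (g_convex (i := pos w0 1) (j := pos None 1)).
rewrite g0 g1 !pos_lt with_last_ltSN andbT.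
by have [->|->] := le_cases (w0'_min (Some k')); rewrite ?eqxx ?orbT.
Qed.
End word_rigidity.

(** Between the two ends, [g] moves no position: the least [j] that is moved
    could be moved neither down, by injectivity, nor up, as [j] would then be
    the image of an earlier position, which is fixed. *)
Lemma word_rigid K (A A' : set K) (g : positions K -> positions K) :
  K ->
  (forall i j, i < j -> g i < g j) ->
  (forall i j k', g i < k' < g j -> exists k, g k = k') ->
  (forall i j, i < j -> word A' (g i) = word A i) -> A = A'.
Proof.
move=> k0 g_lt g_convex g_word.
have [w0 w0_min] := exists_first k0.
have [g0 g1] := ends_image g_lt g_convex g_word w0_min w0_min k0.
set b := pos w0 1 in g0; set t := pos None 1 in g1.
have g_id j : b <= j -> j <= t -> g j = j.
  elim/(well_ordered_ind (@positions_well_ordered K)): j => j IH bj jt.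
  have [<-//|{}bj] := le_cases bj.
  have [gj|jg|//] := ltgtP (g j) j.
    have := g_lt _ _ gj; rewrite (IH (g j)) ?ltxx //.
      by apply: ltW; rewrite -g0; exact: g_lt.
    exact: le_trans (ltW gj) jt.
  have [|i ij] := g_convex b j j; first by rewrite g0 bj.
  have ilt : i < j.
    rewrite ltNge; apply/negP => /le_cases[ji|/g_lt].
      by move: jg; rewrite {2}ji ij ltxx.
    by rewrite ij (lt_gtF jg).
  have bi : b <= i.
    rewrite leNgt; apply/negP => /g_lt; rewrite ij g0 => jb.
    by move: (lt_trans bj jb); rewrite ltxx.
  have := IH i ilt bi (le_trans (ltW ilt) jt); rewrite ij => ji.
  by move: ilt; rewrite -ji ltxx.
apply/seteqP; suff AA k : A k <-> A' k by split=> k /AA.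
have gk : g (pos (Some k) 4) = pos (Some k) 4.
  apply: g_id; apply: ltW; rewrite pos_lt; last by rewrite with_last_ltSN.
  by have [->|->] := le_cases (w0_min (Some k)); rewrite ?eqxx ?orbT.
have := g_word _ _ (pos_lt_last (Some k) 4); rewrite gk !word_bit => E.
by split=> /asboolP H; apply/asboolP; [rewrite E|rewrite -E].
Qed.

(** * The first uncountable ordinal *)

Lemma countable_setU1 T (A : set T) x : countable A -> countable (x |` A).
Proof.
move=> cA; have [fA|iA] := pselect (finite_set A).
  by apply: finite_set_countable; rewrite finite_setU; split.
exact: card_le_trans (infinite_card_setU1 x iA) cA.
Qed.

Section cardinal_arithmetic.
Context {K : Type}.
Hypothesis Kinf : infinite_set [set: K].

Lemma card_le_option T : [set: T] #<= [set: K] -> [set: option T] #<= [set: K].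
Proof.
move=> TK; apply: (@card_le_trans _ _ _ [set: option K]).
  have [[t]|nT] := pselect (inhabited T).
    have [f fI] := card_leT_inj t TK.
    by apply: (inj_card_leT (f := omap f)) => -[x|] [y|] //= [/fI ->].
  have nT' (x : T) : False by apply: nT.
  apply: (inj_card_leT (f := fun=> None)) => -[x|] [y|] //;
    by case: (nT' x) || case: (nT' y).
have -> : [set: option K] = None |` (some @` [set: K]).
  by apply/seteqP; split=> // -[x|] _; [right; exists x|left].
have sK : some @` [set: K] #<= [set: K] by exact: card_image_le.
apply: card_le_trans sK; apply: infinite_card_setU1 => fin; apply: Kinf.
apply: card_le_finite fin; apply: (fun_card_le (f := some)); first by move=> x _; exists x.
by move=> x y _ _ [].
Qed.

Lemma card_le_prod T U : [set: T] #<= [set: K] -> [set: U] #<= [set: K] ->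
  [set: T * U] #<= [set: K].
Proof.
move=> TK UK; apply: card_le_trans (infinite_card_square Kinf).
by rewrite -!setXTT; exact: card_le_setX.
Qed.

Lemma card_le_countType (T : countType) : [set: T] #<= [set: K].
Proof. by apply: card_le_trans (countableP _) _; exact/infiniteP. Qed.
End cardinal_arithmetic.

Lemma gt_aleph0_infinite K : gt_aleph0 K -> infinite_set [set: K].
Proof. by case=> KN _; apply/infiniteP. Qed.

Lemma gt_aleph0_uncountable K : gt_aleph0 K -> ~ countable [set: K].
Proof.
by case=> NK /negP neq cK; apply: neq; rewrite card_eqPle.
Qed.

Section omega1.
Variable K : Type.

(** The last element [None] ensures that some element has uncountably many
    predecessors, even if every proper initial segment of the well-order of [K]
    is countable. *)
Definition omega1 : with_last (WO K) :=
  xget (None : with_last (WO K)) [set v : with_last (WO K) |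
    ~ countable [set w | w < v] /\
    forall u : with_last (WO K), ~ countable [set w | w < u] -> v <= u].

Hypothesis K_large : gt_aleph0 K.

Lemma omega1P : ~ countable [set w | w < omega1] /\
  forall u, u < omega1 -> countable [set w | w < u].
Proof.
have [|v vP vmin] := with_last_well_ordered (@WO_well_ordered K)
    (P := [set v | ~ countable [set w | w < v]]).
  exists None => /= c; apply: (gt_aleph0_uncountable K_large).
  apply: sub_countable c; apply: (fun_card_le (f := some)).
    by move=> k _ /=; exact: with_last_ltSN.
  by move=> x y _ _ [].
rewrite /omega1; case: xgetP => [w _ [wP wmin]|/(_ v)[]//].
split=> // u uw; apply: contrapT => /wmin; by rewrite leNgt uw.
Qed.

Definition closed_omega1 : orderType (Order.Disp tt tt) :=
  suborder (fun v : with_last (WO K) => v <= omega1).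

Definition omega1_top : closed_omega1 :=
  exist (fun v => is_true (v <= omega1)) omega1 (lexx omega1).

Lemma closed_omega1_well_ordered : well_ordered closed_omega1.
Proof.
move=> P [x Px].
have [|v [y Py <-] vmin] := with_last_well_ordered (@WO_well_ordered K) (P := val @` P).
  by exists (val x), x.
by exists y => // z Pz; rewrite leEsub; apply: vmin; exists z.
Qed.

Lemma omega1_top_ge (u : closed_omega1) : u <= omega1_top.
Proof. by rewrite leEsub; exact: svalP u. Qed.

Lemma omega1_top_small (u : closed_omega1) : u < omega1_top ->
  countable [set v | v <= u].
Proof.
rewrite ltEsub => /(proj2 omega1P) /(countable_setU1 (val u)).
apply: sub_countable.
apply: (fun_card_le (f := fun v : closed_omega1 => val v)) => [v|v w _ _ /val_inj//].
by rewrite /= leEsub le_eqVlt => /predU1P.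
Qed.

Lemma omega1_top_large : ~ countable [set v | v < omega1_top].
Proof.
move=> c; apply: (proj1 omega1P); apply: sub_countable c.
apply: (fun_card_le (f := fun w => insubd omega1_top w : closed_omega1)).
  by move=> w /= wlt; rewrite ltEsub insubdK //; exact: ltW.
move=> v w /ltW vo /ltW wo /(congr1 val).
by rewrite !insubdK.
Qed.

Lemma card_closed_omega1 : [set: closed_omega1] #<= [set: K].
Proof.
apply: card_le_trans (card_le_option (gt_aleph0_infinite K_large) (card_lexx _)).
by apply: (inj_card_leT (f := val)); exact: val_inj.
Qed.
End omega1.

(** * The continua *)

Section word_continuum.
Context {K : Type} (A : set K).

Definition skeleton : orderType (Order.Disp tt tt) :=
  @tlex (positions K) (closed_omega1 K) (word A).
Definition word_continuum : orderTopologicalType (Order.Disp tt tt) :=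
  order_topology (fill skeleton).

Definition mark (j : positions K) : word_continuum :=
  fill0 ((j, omega1_top K) : skeleton).

Lemma skeleton_complete : complete skeleton.
Proof.
apply: tlex_complete.
  exact: well_ordered_complete (@positions_well_ordered K) (@positions_le_last K).
exact: well_ordered_complete (@closed_omega1_well_ordered K) (@omega1_top_ge K).
Qed.

Lemma word_continuum_complete : complete word_continuum.
Proof. exact: fill_complete skeleton_complete. Qed.

Lemma word_continuum_dense : densely_ordered word_continuum.
Proof. exact: fill_dense. Qed.

Lemma mark_lt i j : (mark i < mark j) = (i < j).
Proof.
transitivity (((i, omega1_top K) : skeleton) < (j, omega1_top K)); first exact: fill0_lt.
by rewrite tlex_ltE /= ltxx if_same andbF orbF.
Qed.

Let eq_coord (x : @tlex skeleton RR (fun=> true)) :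
  x = ((x.1.1, x.1.2) : skeleton, x.2).
Proof. by case: x => [[]]. Qed.

Hypothesis K_large : gt_aleph0 K.

Lemma mark_left j : word A j -> unreachable <%O (mark j).
Proof.
move=> ej; apply/fill_unreachable_lt; split=> //=.
exact (block_top_unreachable_lt (omega1_top_small K_large) (omega1_top_large K_large) ej).
Qed.

Lemma mark_right j : ~~ word A j -> unreachable (fun x y => y < x) (mark j).
Proof.
move=> ej; apply/fill_unreachable_gt; split=> //=.
exact (block_top_unreachable_gt (omega1_top_small K_large) (omega1_top_large K_large) ej).
Qed.

Lemma left_mark x : unreachable <%O x -> exists j, x = mark j.
Proof.
move=> /fill_unreachable_lt[x0 xU]; exists (val x).1.1.
have uE : (val x).1.2 = omega1_top K.
  apply: (unreachable_lt_block (closed_omega1_well_ordered (K := K))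
    (@omega1_top_ge K) (omega1_top_small K_large) (@word_succ K A)
    (j := (val x).1.1)).
  by move: xU; case: (val x).1.
by apply: val_inj; rewrite [val x]eq_coord uE x0.
Qed.

Lemma right_mark x : unreachable (fun x y => y < x) x ->
  exists2 j, x = mark j & ~~ word A j.
Proof.
move=> /fill_unreachable_gt[x0 xU].
have [uE ej] : (val x).1.2 = omega1_top K /\ ~~ word A (val x).1.1.
  apply: (unreachable_gt_block (@positions_well_ordered K)
    (closed_omega1_well_ordered (K := K))
    (@omega1_top_ge K) (omega1_top_small K_large)).
  by move: xU; case: (val x).1.
exists (val x).1.1 => //.
by apply: val_inj; rewrite [val x]eq_coord uE x0.
Qed.
End word_continuum.

Lemma gt_aleph0_inhabited K : gt_aleph0 K -> [set: K] !=set0.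
Proof. by move=> /gt_aleph0_infinite/infinite_setN0. Qed.

Lemma card_positions K : infinite_set [set: K] -> [set: positions K] #<= [set: K].
Proof.
move=> Kinf; apply: (card_le_option Kinf).
apply: (@card_le_trans _ _ _ [set: option K * nat]); first exact: card_lexx.
apply: (card_le_prod Kinf); last exact: card_le_countType.
by apply: (card_le_option Kinf); exact: card_lexx.
Qed.

(** The sequence required by [not_decreasing] is the last block, which has
    order type omega. *)
Lemma word_continuum_embedding K K' (A : set K) (A' : set K') :
  gt_aleph0 K -> gt_aleph0 K' ->
  embeddable (word_continuum A) (word_continuum A') ->
  exists g : positions K -> positions K',
  [/\ forall i j, i < j -> g i < g j,
      forall i j k', g i < k' < g j -> exists k, g k = k' &
      forall i j, i < j -> word A' (g i) = word A i].
Proof.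
move=> KL KL' /(embeddable_monotone (@word_continuum_complete K A)
  (@word_continuum_dense K A))[h [hconv [hinc|hdec]]].
  apply: (word_embedding (@mark_lt K A) (@mark_lt K' A')
    (@mark_left K A KL) (@mark_right K A KL) (@left_mark K A KL) (@right_mark K A KL)
    (@mark_left K' A' KL') (@mark_right K' A' KL')
    (@left_mark K' A' KL') (@right_mark K' A' KL') hconv hinc).
exfalso.
apply: (not_decreasing (@mark_lt K A) (@mark_lt K' A')
    (@mark_left K A KL) (@mark_right K A KL) 
    (@left_mark K' A' KL') (@right_mark K' A' KL')
    (@positions_well_ordered K') (s := fun n => pos None n) _ hconv hdec).
by move=> n; rewrite pos_lt eqxx ltnSn orbT.
Qed.

(** For the inequality that does not follow from the injectivity of the map on
    positions: the bits of the second word all lie between its two ends, hence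
    in the image of the positions of the first one. *)
Lemma embeddable_same_card K K' (A : set K) (A' : set K') :
  gt_aleph0 K -> gt_aleph0 K' ->
  embeddable (word_continuum A) (word_continuum A') -> [set: K] #= [set: K'].
Proof.
move=> KL KL' /(word_continuum_embedding KL KL')[g [g_lt g_convex g_word]].
have [k0 _] := gt_aleph0_inhabited KL; have [k0' _] := gt_aleph0_inhabited KL'.
have [w0 w0_min] := exists_first k0; have [w0' w0'_min] := exists_first k0'.
have g_inj : injective g.
  by move=> i j ij; have [/g_lt|/g_lt|//] := ltgtP i j; rewrite ij ltxx.
rewrite card_eqPle; split.
  apply: card_le_trans (card_positions (gt_aleph0_infinite KL')).
  apply: (inj_card_leT (f := fun k => g (pos (Some k) 0))).
  by move=> k k' /g_inj [].
apply: card_le_trans (card_positions (gt_aleph0_infinite KL)).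
have [f fE] := boolp.choice (bit_preimage g_lt g_convex g_word w0_min w0'_min k0).
apply: (inj_card_leT (f := f)) => k k' /(congr1 g).
by rewrite !fE => -[].
Qed.

Lemma embeddable_same_word K (A A' : set K) : gt_aleph0 K ->
  embeddable (word_continuum A) (word_continuum A') -> A = A'.
Proof.
move=> KL /(word_continuum_embedding KL KL)[g [g_lt g_convex g_word]].
have [k0 _] := gt_aleph0_inhabited KL.
exact: word_rigid k0 g_lt g_convex g_word.
Qed.

(** * Weight *)

Lemma basis_card_ge (X : topologicalType) I (O : I -> set X) (B : set (set X)) :
  (forall i, open (O i)) -> (forall i, O i !=set0) ->
  (forall i j x, O i x -> O j x -> i = j) -> basis B -> [set: I] #<= B.
Proof.
move=> Oopen Oneq0 Odisj [_ Bbase].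
have [f fP] := boolp.choice (P := fun i b => B b /\ b !=set0 /\ b `<=` O i)
  (fun i : I => let: ex_intro x Ox := Oneq0 i in
    let: ex_intro2 b (conj Bb bx) bO :=
      Bbase x (O i) (open_nbhs_nbhs (conj (Oopen i) Ox)) in
    ex_intro _ b (conj Bb (conj (ex_intro _ x bx) bO))).
apply: (fun_card_le (f := f)) => [i _|i j _ _ fij]; first by case: (fP i).
have [_ [[x fx] fO]] := fP i; have [_ [_ fO']] := fP j.
by apply: (Odisj i j x); [exact: fO | apply: fO'; rewrite -fij].
Qed.

Section weight.
Context {K : Type} (A : set K).
Hypothesis K_large : gt_aleph0 K.
Let Kinf : infinite_set [set: K] := gt_aleph0_infinite K_large.
Local Notation X := (word_continuum A).

Lemma card_skeleton : [set: skeleton A] #<= [set: K].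
Proof.
apply: (@card_le_trans _ _ _ [set: positions K * closed_omega1 K]).
  exact: card_lexx.
by apply: card_le_prod => //; [exact: card_positions|exact: card_closed_omega1].
Qed.

Let D : set X := @rational_point _ (skeleton A).

Let D_card : D #<= [set: K].
Proof.
apply: (@card_le_trans _ _ _ [set: skeleton A * rat]); last first.
  by apply: card_le_prod => //; [exact: card_skeleton|exact: card_le_countType].
pose q (x : X) : rat := if pselect (D x) is left Dx then sval (cid Dx) else 0%R.
have qE x : D x -> (val x).2 = ratr (q x) :> RR.
  by move=> Dx; rewrite /q; case: pselect => // Dx'; case: cid.
apply: (fun_card_le (f := fun x : X => ((val x).1, q x))) => // x y Dx Dy [xy1 xy2].
have xy2' : (val x).2 = (val y).2 by rewrite (qE x Dx) (qE y Dy) xy2.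
apply: val_inj; rewrite (surjective_pairing (val x)) (surjective_pairing (val y)).
by rewrite xy1 xy2'.
Qed.

Let ends : set (option X) := None |` (some @` D).

Let ends_card : ends #<= [set: K].
Proof.
apply: (@card_le_trans _ _ _ [set: option K]); last first.
  by apply: card_le_option => //; exact: card_lexx.
have [D0|/set0P[d Dd]] := eqVneq D set0.
  rewrite /ends D0 image_set0 setU0.
  by apply: (fun_card_le (f := fun=> None)) => // x y -> ->.
have [|f _ fI] := card_le_fun _ D_card; first by exists d.
apply: (fun_card_le (f := omap f)) => // _ _ [->|[x Dx <-]] [->|[y Dy <-]] //= [].
by move=> /fI ->.
Qed.

Definition rational_intervals : set (set X) :=
  [set between lr.1 lr.2 | lr in ends `*` ends].

Lemma rational_intervals_card : rational_intervals #<= [set: K].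
Proof.
apply: (card_le_trans (card_image_le _ _)).
apply: card_le_trans (infinite_card_square Kinf).
by rewrite -setXTT; exact: card_le_setX.
Qed.

Lemma rational_intervals_basis : basis rational_intervals.
Proof.
split=> [_ [[l r] _ <-]|x U /nbhs_between[l [r [[lx xr] lrU]]]].
  exact: between_open.
have [l' l'D [l'x ll']] : exists2 l', ends l' & oapp (fun a => a < x) true l' /\
    forall z, oapp (fun a => a < z) true l' -> oapp (fun a => a < z) true l.
  case: l lx {lrU} => [a|] /= ax; last by exists None; [left|].
  have [d Dd /andP[ad dx]] := fill_rational_dense ax.
  exists (Some d); first by right; exists d.
  split; first exact: dx.
  move=> z /= dz; exact: (lt_trans ad dz).
have [r' r'D [xr' rr']] : exists2 r', ends r' & oapp (fun a => x < a) true r' /\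
    forall z, oapp (fun a => z < a) true r' -> oapp (fun a => z < a) true r.
  case: r xr {lrU} => [b|] /= xb; last by exists None; [left|].
  have [d Dd /andP[xd db]] := fill_rational_dense xb.
  exists (Some d); first by right; exists d.
  split; first exact: xd.
  move=> z /= zd; exact: (lt_trans zd db).
exists (between l' r').
  by split; [exists (l', r') | split].
by move=> z [lz zr]; apply: lrU; split; [exact: ll'|exact: rr'].
Qed.

Lemma card_le_basis (B : set (set X)) : basis B -> [set: K] #<= B.
Proof.
pose m (k : K) n := mark A (pos (Some k) n).
pose O (k : K) : set X := between (Some (m k 0%N)) (Some (m k 1%N)).
apply: (basis_card_ge (O := O)).
- by move=> k; exact: between_open.
- move=> k; have [|z /andP[z0 z1]] := @word_continuum_dense K A (m k 0%N) (m k 1%N).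
    by rewrite mark_lt pos_lt eqxx orbT.
  by exists z; split.
- move=> k k' x [/= kx xk] [/= kx' xk'].
  have lt1 : pos (Some k) 0 < pos (Some k') 1.
    by rewrite -(mark_lt A); exact: (lt_trans kx xk').
  have lt2 : pos (Some k') 0 < pos (Some k) 1.
    by rewrite -(mark_lt A); exact: (lt_trans kx' xk).
  move: lt1 lt2; rewrite !pos_lt !with_last_ltS.
  have [kk|kk|kk _ _] := ltgtP (k : WO K) k'; last exact: kk.
  + rewrite /= (_ : _ == _ = false) //; apply/negbTE.
    by apply: contraTneq kk => -[->]; rewrite ltxx.
  + rewrite /= (_ : _ == _ = false) //; apply/negbTE.
    by apply: contraTneq kk => -[->]; rewrite ltxx.
Qed.

Lemma word_continuum_weight : has_weight X K.
Proof.
split=> //; last by move=> B /card_le_basis.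
exists rational_intervals; first exact: rational_intervals_basis.
rewrite card_eqPle; split; first exact: rational_intervals_card.
exact: card_le_basis rational_intervals_basis.
Qed.

End weight.

(** * Size *)

Section ternary_code.
Local Open Scope ring_scope.

Let c : RR := 3%:R^-1.

Let c_gt0 n : 0 < c ^+ n.
Proof. by rewrite exprn_gt0 // invr_gt0. Qed.

Let cS n : c ^+ n = 3%:R * c ^+ n.+1.
Proof. by rewrite exprS mulrA divff ?mul1r // pnatr_eq0. Qed.

(** Partial sums of the expansion in base 3, with digits 0 and 2, of a point of
    the Cantor set. *)
Fixpoint ternary_sum (A : set nat) (n : nat) : RR :=
  if n is m.+1 then ternary_sum A m + (if `[< A m >] then 2%:R * c ^+ m.+1 else 0)
  else 0.

Let sum_step A n : ternary_sum A n <= ternary_sum A n.+1 /\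
  ternary_sum A n.+1 + c ^+ n.+1 <= ternary_sum A n + c ^+ n.
Proof.
have := c_gt0 n.+1; rewrite (cS n) /= => c0.
by case: ifP => _; split; lra.
Qed.

Let sum_mono A n k : ternary_sum A n <= ternary_sum A (n + k) /\
  ternary_sum A (n + k) + c ^+ (n + k) <= ternary_sum A n + c ^+ n.
Proof.
elim: k => [|k [IH1 IH2]]; first by rewrite addn0.
have [s1 s2] := sum_step A (n + k); rewrite addnS; split.
  exact: le_trans IH1 s1.
exact: le_trans s2 IH2.
Qed.

Definition ternary_code A : RR := sup (range (ternary_sum A)).

Let code_bounds A n : ternary_sum A n <= ternary_code A <= ternary_sum A n + c ^+ n.
Proof.
have ub m : ternary_sum A m <= ternary_sum A n + c ^+ n.
  have [nm|mn] := leP n m.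
    rewrite -(subnKC nm); have [_] := sum_mono A n (m - n); apply: le_trans.
    by rewrite lerDl ltW.
  rewrite -(subnKC (ltW mn)); have [+ _] := sum_mono A m (n - m).
  by move=> /le_trans; apply; rewrite lerDl ltW.
have hs : has_sup (range (ternary_sum A)).
  split; first by exists (ternary_sum A 0), 0%N.
  by exists (ternary_sum A n + c ^+ n) => _ [m _ <-].
apply/andP; split; first by apply: (sup_upper_bound hs); exists n.
by apply: ge_sup; [exists (ternary_sum A 0), 0%N | move=> _ [m _ <-]].
Qed.

Lemma ternary_code01 A : 0 <= ternary_code A <= 1.
Proof. by have := code_bounds A 0; rewrite /= add0r expr0. Qed.

(** At the first digit where they differ, the two expansions are separated by
    the middle third that is left out. *)
Let code_lt A B n : (forall m, (m < n)%N -> A m <-> B m) -> A n -> ~ B n ->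
  ternary_code B < ternary_code A.
Proof.
move=> AB An nBn.
have sAB : forall m, (m <= n)%N -> ternary_sum A m = ternary_sum B m.
  elim=> [//|m IH] mn /=; have -> : `[< A m >] = `[< B m >] by exact/asbool_equiv_eq/AB.
  by rewrite IH // ltnW.
have /andP[+ _] := code_bounds A n.+1; have /andP[_] := code_bounds B n.+1.
rewrite /= (asboolT An) (asboolF nBn) sAB // addr0.
have := c_gt0 n.+1 => c0 h1 h2; lra.
Qed.

Lemma ternary_code_inj : injective ternary_code.
Proof.
move=> A B AB; apply: contrapT => neq.
have [|n nn nmin] := nat_well_ordered (P := [set n | ~ (A n <-> B n)]).
  apply: contrapT => nn; apply: neq; apply/seteqP.
  have AB' n : A n <-> B n by apply: contrapT => h; apply: nn; exists n.
  by split=> n /AB'.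
have agree m : (m < n)%N -> A m <-> B m.
  by move=> mn; apply: contrapT => /nmin; rewrite leEnat leqNgt mn.
have [An|nAn] := pselect (A n); have [Bn|nBn] := pselect (B n).
- by apply: nn.
- by have := code_lt agree An nBn; rewrite AB ltxx.
- have agree' m : (m < n)%N -> B m <-> A m by move=> /agree [].
  by have := code_lt agree' Bn nAn; rewrite AB ltxx.
- by apply: nn.
Qed.
End ternary_code.

Lemma card_le_set T U : [set: T] #<= [set: U] -> [set: set T] #<= [set: set U].
Proof.
move=> TU; have [[t]|nT] := pselect (inhabited T).
  have [f fI] := card_leT_inj t TU.
  apply: (inj_card_leT (f := fun A => f @` A)) => A B /seteqP[AB BA].
  apply/seteqP; split=> x Ax.
    by have [|y By /fI <-] := AB (f x); first by exists x.
  by have [|y By /fI <-] := BA (f x); first by exists x.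
apply: (inj_card_leT (f := fun _ => set0)) => A B _.
by apply/seteqP; split=> x; case: nT.
Qed.

Lemma infinite_set_nat : infinite_set [set: set nat].
Proof.
apply/infiniteP; apply: (inj_card_leT (f := fun n => [set n])).
by move=> n m /seteqP[/(_ n erefl)].
Qed.

Section size.
Context {K : Type} (A : set K).
Hypothesis K_large : gt_aleph0 K.
Let Kinf : infinite_set [set: K] := gt_aleph0_infinite K_large.
Local Notation X := (word_continuum A).

(** Two consecutive elements of omega_1 in a block in natural order. *)
Lemma skeleton_jump : exists s : skeleton A, jump s.
Proof.
have [u uoo] : exists u, u < omega1_top K.
  apply: contrapT => nu; apply: (omega1_top_large K_large).
  apply: sub_countable (@countable0 (closed_omega1 K)).
  by apply: subset_card_le => u uoo; case: nu; exists u.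
have [v uv vnext] := well_ordered_jump (closed_omega1_well_ordered (K := K)) uoo.
have [j ej] : exists j, word A j.
  by exists (pos None 1); exact: extremal_word extremal_last _.
exists ((j, u) : skeleton A); exists ((j, v) : skeleton A).
  by rewrite tlex_ltE /= eqxx ej uv orbT.
move=> [i w]; rewrite !tlex_ltE /=; case: ltgtP => //= jE; subst i.
by rewrite ej; exact: vnext.
Qed.

Lemma card_le_word_continuum : [set: K] #<= [set: X].
Proof.
apply: (inj_card_leT (f := fun k => mark A (pos (Some k) 0))).
by move=> k k' /fill0_inj [].
Qed.

Lemma continuum_le_word_continuum : [set: set nat] #<= [set: X].
Proof.
have [s js] := skeleton_jump.
(* Halving keeps the coordinate below 1. *)
have ex (B : set nat) :
    exists x : fill (skeleton A), val x = (s, (ternary_code B / 2%:R)%R).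
  have /andP[c0 c1] := ternary_code01 B.
  by apply: fill_point => //; apply/andP; split; lra.
have [f fE] := boolp.choice ex.
apply: (inj_card_leT (f := f : set nat -> X)) => B B' /(congr1 val).
rewrite !fE => -[] BB; apply: ternary_code_inj.
lra.
Qed.

(** The coordinate in a jump is encoded by its Dedekind cut in the rationals. *)
Lemma word_continuum_card_le : [set: X] #<= [set: K * set nat].
Proof.
apply: (@card_le_trans _ _ _ [set: skeleton A * set rat]); last first.
  rewrite -[X in X #<= _]setXTT -[X in _ #<= X]setXTT.
  apply: card_le_setX; first exact (card_skeleton A K_large).
  by apply: card_le_set; exact: (countableP (T := rat)).
pose f (x : X) := ((val x).1, [set q : rat | ratr q < (val x).2 :> RR]).
apply: (inj_card_leT (f := f)).
have cut (a b : RR) : [set q : rat | ratr q < a] = [set q : rat | ratr q < b] -> (a <= b)%R.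
  move=> ab; rewrite leNgt; apply/negP => ba.
  have [q] := rat_in_itvoo ba; rewrite in_itv /= => /andP[bq qa].
  have : [set q : rat | ratr q < a] q by [].
  by rewrite ab /= ltNge (ltW bq).
move=> x y [xy1 xy2].
have xy2' : (val x).2 = (val y).2 by apply/le_anti; rewrite !cut.
apply: val_inj; rewrite (surjective_pairing (val x)) (surjective_pairing (val y)).
by rewrite xy1 xy2'.
Qed.

Lemma word_continuum_size : card_eq_max [set: X] [set: K] [set: set nat].
Proof.
have [Kc|cK] := card_le_total [set: K] [set: set nat]; [left|right]; split=> //.
  rewrite card_eqPle; split; last exact: continuum_le_word_continuum.
  apply: (card_le_trans word_continuum_card_le).
  by apply: (card_le_prod infinite_set_nat).
rewrite card_eqPle; split; last exact: card_le_word_continuum.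
apply: (card_le_trans word_continuum_card_le).
by apply: (card_le_prod Kinf).
Qed.

Lemma word_continuum_continuum : continuum X.
Proof.
split.
- exact: complete_compact (@word_continuum_complete K A).
- exact: complete_connected (@word_continuum_complete K A) (@word_continuum_dense K A).
- exact: order_hausdorff.
- exists (mark A (pos None 0)), (mark A (pos None 1)) => E.
  have := @mark_lt K A (pos None 0) (pos None 1).
  by rewrite E ltxx pos_lt eqxx orbT.
Qed.
End size.

(** * The class *)

(** The choice among the types of the cardinality of [K] depends on the set of
    these types only, hence it is the same for two types of the same
    cardinality. *)
Definition representative (K : Type) : Type :=
  sval (cid (ex_intro (fun K' : Type => [set: K'] #= [set: K])
    K (card_eqxx [set: K]))).

Lemma card_representative K : [set: representative K] #= [set: K].
Proof. by rewrite /representative; case: cid. Qed.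

Lemma representative_eq K K' : [set: K] #= [set: K'] ->
  representative K = representative K'.
Proof.
move=> KK'; rewrite /representative.
move: (ex_intro _ K _) (ex_intro _ K' _).
suff -> : (fun T : Type => [set: T] #= [set: K] : Prop) =
    (fun T : Type => [set: T] #= [set: K'] : Prop).
  by move=> p q; rewrite (Prop_irrelevance p q).
by apply: functional_extensionality_dep => T; rewrite (card_eqr KK').
Qed.

Lemma gt_aleph0_card_eq K K' : [set: K] #= [set: K'] -> gt_aleph0 K -> gt_aleph0 K'.
Proof.
move=> KK' [NK nNK]; split; first by rewrite -(card_le_eqr KK').
by rewrite -(card_eqr KK').
Qed.

Lemma eq_embeddable (X Y : topologicalType) : X = Y -> embeddable X Y.
Proof.
move=> <-.
pose f (x : X) : set_type [set: X] := SigSub (mem_setT x).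
exists [set: X], f, val; split => //.
- by move=> x; exact: val_inj.
- by apply: continuous_comp_initial => x.
- exact: initial_continuous.
Qed.

Lemma has_weight_unique (X : topologicalType) K K' :
  has_weight X K -> has_weight X K' -> [set: K] #= [set: K'].
Proof.
suff le K1 K2 : has_weight X K1 -> has_weight X K2 -> [set: K2] #<= [set: K1].
  by move=> ? ?; rewrite card_eqPle; split; exact: le.
move=> [K1inf [B Bb BK] _] [_ _ K2le]; rewrite -(card_le_eqr BK); apply: K2le => //.
by move=> Bfin; apply: K1inf; rewrite -(eq_finite_set BK).
Qed.

Lemma has_weight_card_eq (X : topologicalType) K K' :
  [set: K] #= [set: K'] -> has_weight X K -> has_weight X K'.
Proof.
move=> KK' [Kinf [B Bb BK] Kle]; split.
- by rewrite -(eq_finite_set KK').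
- by exists B => //; rewrite -(card_eqr KK').
- by move=> C Cb Cinf; rewrite -(card_le_eql KK'); exact: Kle.
Qed.

Lemma card_eq_max_card_eq T U U' V (A : set T) (B : set V) :
  [set: U] #= [set: U'] -> card_eq_max A [set: U] B -> card_eq_max A [set: U'] B.
Proof.
by move=> UU'; rewrite /card_eq_max (card_le_eql UU') (card_le_eqr UU') (card_eqr UU').
Qed.

Lemma card_eq_cancel T U : [set: T] #= [set: U] ->
  exists (f : T -> U) (g : U -> T), cancel f g /\ cancel g f.
Proof.
move=> /card_bijP[f [g fK gK]].
exists (fun t => val (f (SigSub (mem_setT t)))), (fun u => val (g (SigSub (mem_setT u)))).
split=> [t|u].
  rewrite (_ : SigSub _ = f (SigSub (mem_setT t))) ?fK //; exact: val_inj.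
rewrite (_ : SigSub _ = g (SigSub (mem_setT u))) ?gK //; exact: val_inj.
Qed.

Definition word_continua (X : topologicalType) : Prop :=
  exists (K : Type) (A : set K),
    [/\ gt_aleph0 K, K = representative K & X = word_continuum A].

Theorem theorem2 :
  exists L : topologicalType -> Prop,
    [/\ forall X : topologicalType, L X ->
          continuum X /\ linearly_ordered_space X,
        pairwise_non_embeddable L
      & forall K : Type, gt_aleph0 K ->
          class_card_eq
            (fun X : topologicalType =>
               [/\ L X, has_weight X K
                 & card_eq_max [set: X] [set: K] [set: set nat]])
            (set K)].
Proof.
exists word_continua; split.
- move=> _ [K [A [KL _ ->]]]; split; first exact: word_continuum_continuum.
  by exists (Order.Disp tt tt), (word_continuum A).
- move=> _ _ [K [A [KL KE ->]]] [K' [A' [KL' KE' ->]]] neq XY; apply: neq.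
  have KK' : K = K'.
    by rewrite KE KE'; apply: representative_eq; exact: embeddable_same_card XY.
  subst K'; congr (word_continuum _ : topologicalType).
  exact: embeddable_same_word XY.
- move=> K KL.
  have [psi [phi [psiK phiK]]] := card_eq_cancel (card_representative K).
  have KLr : gt_aleph0 (representative K).
    by apply: gt_aleph0_card_eq KL; rewrite card_eq_sym; exact: card_representative.
  exists (fun B : set K => word_continuum (psi @^-1` B)); split.
    move=> B B' E; have := embeddable_same_word KLr (eq_embeddable E).
    move=> /seteqP[BB' B'B]; apply/seteqP; split=> k Bk.
      by have := BB' (phi k); rewrite /= phiK; apply.
    by have := B'B (phi k); rewrite /= phiK; apply.
  move=> X; split.
  + move=> [[K1 [A [K1L K1E ->]]] wX _].
    have K1K : K1 = representative K.
      rewrite K1E; apply: representative_eq.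
      exact: has_weight_unique (word_continuum_weight A K1L) wX.
    subst K1; exists (phi @^-1` A); congr (word_continuum _ : topologicalType).
    by apply/seteqP; split=> k /=; rewrite psiK.
  + move=> [B ->]; split.
    * exists (representative K), (psi @^-1` B); split=> //.
      by apply/esym/representative_eq; exact: card_representative.
    * apply: has_weight_card_eq (card_representative K) _.
      exact: word_continuum_weight.
    * apply: card_eq_max_card_eq (card_representative K) _.
      exact: word_continuum_size.
Qed.
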